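(* For every $k\in\mathbf N$, the flat cone of cone angle $\frac{2\pi}{k}$ whose boundary circle has length $2\pi$ is Steklov isospectral to the flat unit disk in $\mathbf R^2$. In particular, the Dirichlet-to-Neumann operator does not always detect the presence of interior orbifold singularities: there exist a compact Riemannian orbisurface with an interior singular point and a smooth compact Riemannian surface, with isometric boundaries, whose Dirichlet-to-Neumann operators coincide under an isometric identification of the boundaries.
   Context: A flat cone (orbifold) of cone angle $\frac{2\pi}{k}$ is the quotient of a flat disk $D\subset\mathbf R^2$ centered at the origin by the cyclic group $\mathbf Z_k$ generated by rotation through angle $\frac{2\pi}{k}$; its boundary is the image of the boundary circle of $D$, and for $k\geq 2$ it has one interior singular point (the image of the origin). Smooth functions on the cone are those that pull back to smooth functions on $D$. For a compact Riemannian orbifold $(\mathcal O,g)$ with boundary, the Dirichlet-to-Neumann operator $\mathcal D_{(\mathcal O,g)}:C^\infty(\partial\mathcal O)\to C^\infty(\partial\mathcal O)$ sends $u$ to $\partial_\nu(Hu)$, where $Hu$ is the unique harmonic extension of $u$ to $\mathcal O$ and $\partial_\nu$ is the outward normal derivative. Its spectrum (with multiplicity) is the Steklov spectrum; two orbifolds are Steklov isospectral if they have the same Steklov spectrum. *)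

(* Defs.v *)
From HB Require Import structures.
From mathcomp Require Import all_boot all_order all_algebra.
From mathcomp Require Import ring.
From mathcomp Require Import all_classical all_reals all_analysis.

Set Implicit Arguments.
Unset Strict Implicit.
Unset Printing Implicit Defensive.

Import Order.TTheory GRing.Theory Num.Theory.
Import numFieldNormedType.Exports.

Local Open Scope classical_set_scope.
Local Open Scope ring_scope.

Section Plane.
Context {R : realType}.

Definition basis_vec (i : 'I_2) : 'rV[R]_2 := delta_mx 0 i.

(* [F s] is the iterated partial derivative of [f] along the word [s].  For
   [U] the interior of a smooth domain with boundary [D], this says that all
   partial derivatives of [f] extend continuously to [D], i.e. that [f] is
   C^oo up to the boundary; for [U = D] open it says that [f] is C^oo on [U]. *)
Definition smooth_upto (U D : set 'rV[R]_2) (f : 'rV[R]_2 -> R) : Prop :=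
  exists F : seq 'I_2 -> 'rV[R]_2 -> R,
    [/\ forall x, D x -> F [::] x = f x,
        forall s, {within D, continuous (F s)} &
        forall s i x, U x -> is_derive x (basis_vec i) (F s) (F (i :: s) x)].

Definition smooth_near (f : R -> R) (t : R) : Prop :=
  \forall s \near t, forall n : nat, derivable (derive1n n f) s 1.

Definition gradient (f : 'rV[R]_2 -> R) (x : 'rV[R]_2) : 'rV[R]_2 :=
  \row_i 'D_(basis_vec i) f x.

Definition inner (g : 'M[R]_2) (v w : 'rV[R]_2) : R := (v *m g *m w^T) 0 0.

End Plane.

(* Orbifold charts are modelled on open subsets of smooth planar domains
   [rho <= 0], the boundary being [rho = 0]; by the implicit function theorem
   this is the same as modelling them on open subsets of a half-plane. *)
Record chart (R : realType) := Chart {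
  ch_open : set 'rV[R]_2;
  ch_rho : 'rV[R]_2 -> R;
  ch_metric : 'rV[R]_2 -> 'M[R]_2;
  ch_group : set ('rV[R]_2 -> 'rV[R]_2)
}.

Section Chart.
Context {R : realType}.
Implicit Types (C : chart R) (x : 'rV[R]_2).

Definition ch_dom C : set 'rV[R]_2 :=
  [set x | ch_open C x /\ ch_rho C x <= 0].
Definition ch_int C : set 'rV[R]_2 :=
  [set x | ch_open C x /\ ch_rho C x < 0].
Definition ch_bd C : set 'rV[R]_2 :=
  [set x | ch_open C x /\ ch_rho C x = 0].

(* Riemannian isometric immersion of [V `&` ch_dom C] into [ch_dom C'],
   preserving boundaries. Since the dimensions agree it is a local isometry. *)
Definition local_isometry C C' (V : set 'rV[R]_2)
    (h : 'rV[R]_2 -> 'rV[R]_2) : Prop :=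
  [/\ forall j, smooth_upto (V `&` ch_int C) (V `&` ch_dom C)
                            (fun x => h x 0 j),
      forall x, V x -> ch_dom C x -> ch_dom C' (h x),
      forall x, V x -> ch_dom C x -> (ch_bd C' (h x) <-> ch_bd C x) &
      forall x, V x -> ch_int C x -> forall v w,
        inner (ch_metric C' (h x)) ('D_v h x) ('D_w h x)
        = inner (ch_metric C x) v w].

(* The elements of [ch_group] only matter through their restrictions to
   [ch_dom], on which they act effectively by construction. *)
Definition wf_chart C : Prop :=
  [/\ [/\ open (ch_open C), connected (ch_dom C),
          smooth_upto (ch_open C) (ch_open C) (ch_rho C) &
          forall x, ch_bd C x -> gradient (ch_rho C) x != 0],
      [/\ forall i j, smooth_upto (ch_int C) (ch_dom C)
                                  (fun x => ch_metric C x i j),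
          forall x, ch_dom C x -> (ch_metric C x)^T = ch_metric C x &
          forall x, ch_dom C x -> forall v, v != 0 ->
            0 < inner (ch_metric C x) v v] &
      [/\ finite_set (ch_group C),
          exists2 e, ch_group C e & forall x, ch_dom C x -> e x = x,
          forall a b, ch_group C a -> ch_group C b ->
            exists2 c, ch_group C c & forall x, ch_dom C x -> c x = a (b x),
          forall a, ch_group C a ->
            exists2 b, ch_group C b & forall x, ch_dom C x -> b (a x) = x &
          forall a, ch_group C a -> local_isometry C C setT a]].

(* Laplace-Beltrami operator. *)
Definition laplacian C (f : 'rV[R]_2 -> R) x : R :=
  (Num.sqrt (\det (ch_metric C x)))^-1 *
  \sum_i 'D_(basis_vec i)
    (fun y => Num.sqrt (\det (ch_metric C y)) *
              \sum_j invmx (ch_metric C y) i j * 'D_(basis_vec j) f y) x.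

Definition outward_normal C x : 'rV[R]_2 :=
  let w := gradient (ch_rho C) x *m invmx (ch_metric C x) in
  (Num.sqrt (inner (ch_metric C x) w w))^-1 *: w.

(* One-sided, since [f] is only meaningful on [ch_dom C]. *)
Definition normal_derivative C (f : 'rV[R]_2 -> R) x : R :=
  lim ((fun t : R => t^-1 * (f (x + t *: outward_normal C x) - f x)) @ 0^'-).

(* Arc-length parametrisation, near time [t], of a piece of the boundary. *)
Definition arclength_curve C (c : R -> 'rV[R]_2) (t : R) : Prop :=
  (forall j, smooth_near (fun s => c s 0 j) t) /\
  \forall s \near t, ch_bd C (c s) /\
    inner (ch_metric C (c s)) ('D_1 c s) ('D_1 c s) = 1.

End Chart.

(* Raw data: the axioms are in [compact_riemannian_orbisurface]. *)
Record orbisurface (R : realType) := Orbisurface {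
  os_top : topologicalType;
  os_set : set os_top;
  os_index : Type;
  os_chart : os_index -> chart R;
  os_map : os_index -> 'rV[R]_2 -> os_top
}.
Arguments os_top {R} O : rename.
Arguments os_set {R} O : rename.
Arguments os_index {R} O : rename.
Arguments os_chart {R} O i : rename.
Arguments os_map {R} O i x : rename.

Section Orbisurface.
Context {R : realType}.
Implicit Type O : orbisurface R.

(* Connectedness is part of the definition: it makes the harmonic extension
   of boundary data unique as soon as the boundary is nonempty. *)
Definition compact_riemannian_orbisurface O : Prop :=
  [/\ [/\ compact (os_set O), connected (os_set O) &
          hausdorff_space (subspace (os_set O))],
      forall i, wf_chart (os_chart O i),
      [/\ forall p, os_set O p <->
            exists i, exists2 x, ch_dom (os_chart O i) x & os_map O i x = p,
          forall i, {within ch_dom (os_chart O i), continuous (os_map O i)},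
          forall i (V : set 'rV[R]_2), open V ->
            exists2 W : set (os_top O), open W &
              os_map O i @` (V `&` ch_dom (os_chart O i)) = W `&` os_set O &
          forall i x y, ch_dom (os_chart O i) x -> ch_dom (os_chart O i) y ->
            (os_map O i x = os_map O i y <->
             exists2 a, ch_group (os_chart O i) a & y = a x)] &
      forall i j x y, ch_dom (os_chart O i) x -> ch_dom (os_chart O j) y ->
        os_map O i x = os_map O j y ->
        exists V : set 'rV[R]_2, exists h : 'rV[R]_2 -> 'rV[R]_2,
          [/\ open V /\ V x, h x = y,
              local_isometry (os_chart O i) (os_chart O j) V h &
              forall z, V z -> ch_dom (os_chart O i) z ->
                os_map O j (h z) = os_map O i z]].

Definition os_bd O : set (os_top O) :=
  [set p | exists i, exists2 x, ch_bd (os_chart O i) x & os_map O i x = p].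
Arguments os_bd : clear implicits.

Definition singular_point O (p : os_top O) : Prop :=
  exists i x a,
    [/\ ch_dom (os_chart O i) x /\ os_map O i x = p,
        ch_group (os_chart O i) a, a x = x &
        exists2 y, ch_dom (os_chart O i) y & a y <> y].

Definition interior_singular_point O (p : os_top O) : Prop :=
  ~ os_bd O p /\ singular_point p.

Definition compact_riemannian_surface O : Prop :=
  compact_riemannian_orbisurface O /\
  (forall p : os_top O, ~ singular_point p).

(* Functions on [O] (resp. on its boundary) are represented by total functions
   on [os_top O], of which only the values on [os_set O] (resp. [os_bd O])
   matter. *)
Definition smooth_fun O (f : os_top O -> R) : Prop :=
  forall i, smooth_upto (ch_int (os_chart O i)) (ch_dom (os_chart O i))
                        (f \o os_map O i).

Definition smooth_bd O (u : os_top O -> R) : Prop :=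
  forall i c t, arclength_curve (os_chart O i) c t ->
    smooth_near (u \o os_map O i \o c) t.

Definition harmonic_extension O (u f : os_top O -> R) : Prop :=
  [/\ smooth_fun f,
      forall i x, ch_int (os_chart O i) x ->
        laplacian (os_chart O i) (f \o os_map O i) x = 0 &
      forall p, os_bd O p -> f p = u p].

Definition dn_operator O (u : os_top O -> R) : os_top O -> R :=
  let Hu := get [set f | harmonic_extension u f] in
  fun p => get [set d | exists i, exists2 x,
    ch_bd (os_chart O i) x /\ os_map O i x = p &
    d = normal_derivative (os_chart O i) (Hu \o os_map O i) x].

Definition steklov_eigenspace O (sigma : R) : set (os_top O -> R) :=
  [set u | smooth_bd u /\
           forall p, os_bd O p -> dn_operator u p = sigma * u p].

Definition steklov_multiplicity O (sigma : R) (n : nat) : Prop :=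
  exists u : 'I_n -> os_top O -> R,
    [/\ forall l, steklov_eigenspace sigma (u l),
        forall a : 'I_n -> R,
          (forall p, os_bd O p -> \sum_l a l * u l p = 0) ->
          forall l, a l = 0 &
        forall v, steklov_eigenspace sigma v ->
          exists a : 'I_n -> R,
            forall p, os_bd O p -> v p = \sum_l a l * u l p].

Definition boundary_circle_of_length O (len : R) : Prop :=
  exists gamma : R -> os_top O,
    [/\ range gamma = os_bd O,
        forall s t, gamma s = gamma t <->
                    exists m : int, t = s + m%:~R * len &
        forall t, exists i, exists2 c, arclength_curve (os_chart O i) c t &
          \forall s \near t, gamma s = os_map O i (c s)].

End Orbisurface.
Arguments os_bd {R} O.

Definition steklov_isospectral (R : realType) (O1 O2 : orbisurface R) : Prop :=
  forall (sigma : R) (n : nat),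
    steklov_multiplicity O1 sigma n <-> steklov_multiplicity O2 sigma n.

(* A bijection of the boundaries that carries arc-length parametrisations to
   arc-length parametrisations. *)
Definition boundary_isometry (R : realType) (O1 O2 : orbisurface R)
    (phi : os_top O1 -> os_top O2) : Prop :=
  set_bij (os_bd O1) (os_bd O2) phi /\
  forall i c t, arclength_curve (os_chart O1 i) c t ->
    exists j, exists2 c', arclength_curve (os_chart O2 j) c' t &
      \forall s \near t, phi (os_map O1 i (c s)) = os_map O2 j (c' s).

Section FlatCone.
Context {R : realType}.

Definition rotation (a : R) (x : 'rV[R]_2) : 'rV[R]_2 :=
  \row_(j < 2) (if j == ord0 then cos a * x 0 ord0 - sin a * x 0 ord_max
                else sin a * x 0 ord0 + cos a * x 0 ord_max).

Definition cyclic_rotations (k : nat) : set ('rV[R]_2 -> 'rV[R]_2) :=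
  [set a | exists m : int, a = rotation (m%:~R * (2 * pi / k%:R))].

Definition same_orbit (k : nat) (x y : 'rV[R]_2) : bool :=
  `[< exists2 a, cyclic_rotations k a & y = a x >].

Lemma rotation0 x : rotation 0 x = x.
Proof.
apply/rowP => j; rewrite mxE cos0 sin0 !mul1r !mul0r subr0 add0r.
have [->//|] := eqVneq j ord0.
case: j => [[|[|//]]] lt_j //= _; congr (x _ _); exact: val_inj.
Qed.

Lemma rotationD a b x : rotation (a + b) x = rotation a (rotation b x).
Proof.
apply/rowP => j; rewrite !mxE /= cosD sinD.
by case: ifP => _; ring.
Qed.

Lemma same_orbit_refl k : reflexive (same_orbit k).
Proof.
move=> x; apply/asboolP; exists (rotation (0%:~R * (2 * pi / k%:R))).
  by exists 0.
by rewrite mul0r rotation0.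
Qed.

Lemma same_orbit_impl k x y : same_orbit k x y -> same_orbit k y x.
Proof.
move=> /asboolP[_ [m ->] ->]; apply/asboolP.
exists (rotation ((- m)%:~R * (2 * pi / k%:R))); first by exists (- m).
by rewrite -rotationD -mulrDl -intrD addNr mul0r rotation0.
Qed.

Lemma same_orbit_sym k : symmetric (same_orbit k).
Proof. by move=> x y; apply/idP/idP; exact: same_orbit_impl. Qed.

Lemma same_orbit_trans k : transitive (same_orbit k).
Proof.
move=> y x z /asboolP[_ [m ->] ->] /asboolP[_ [n ->] ->]; apply/asboolP.
exists (rotation ((n + m)%:~R * (2 * pi / k%:R))); first by exists (n + m).
by rewrite -rotationD -mulrDl -intrD.
Qed.

Canonical orbit_equiv (k : nat) := EquivRel (same_orbit k)
  (@same_orbit_refl k) (@same_orbit_sym k) (@same_orbit_trans k).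

Definition orbit_space (k : nat) : Type :=
  quotient_topology {eq_quot (orbit_equiv k)}%qT.

HB.instance Definition _ (k : nat) := Topological.on (orbit_space k).

Definition orbit_map (k : nat) (x : 'rV[R]_2) : orbit_space k :=
  (\pi_{eq_quot (orbit_equiv k)} x)%qT.

Definition disk_rho (r : R) (x : 'rV[R]_2) : R :=
  x 0 ord0 ^+ 2 + x 0 ord_max ^+ 2 - r ^+ 2.

Definition disk_chart (r : R) (G : set ('rV[R]_2 -> 'rV[R]_2)) : chart R :=
  Chart setT (disk_rho r) (fun=> 1%:M) G.

Definition flat_disk (r : R) : orbisurface R :=
  @Orbisurface R 'rV[R]_2 [set x | disk_rho r x <= 0] unit
    (fun=> disk_chart r [set id]) (fun=> id).

(* The quotient by the rotations through multiples of [2 pi / k] of the flat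
   disk of radius [r]. *)
Definition flat_cone (k : nat) (r : R) : orbisurface R :=
  @Orbisurface R (orbit_space k) (orbit_map k @` [set x | disk_rho r x <= 0])
    unit (fun=> disk_chart r (cyclic_rotations k)) (fun=> orbit_map k).

End FlatCone.

(* Main.v *)
(* Let u be a smooth function on the unit circle, with Fourier series
   u (e^{i s}) = sum_n a_n cos (n s) + b_n sin (n s). Its harmonic extension to the
   unit disk is sum_n a_n Re z^n + b_n Im z^n, whose outward normal derivative is
   sum_n n (a_n cos (n s) + b_n sin (n s)). A cone of angle 2 pi / k has boundary
   length 2 pi exactly when its radius is k, and then [k e^{i t}] |-> e^{i k t} is an
   isometry of its boundary onto the unit circle. The pull-back of u extends to
   sum_n a_n Re (z/k)^{k n} + b_n Im (z/k)^{k n}, which is invariant under the cyclic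
   group; the exponent k n and the radius k cancel in the normal derivative, so
   this isometry intertwines the two Dirichlet-to-Neumann operators.

   The Fourier coefficients decay rapidly, hence all partial derivatives of these
   series converge on the closed disk; uniqueness of the harmonic extensions is
   the maximum principle. *)

Require Import Defs.
From HB Require Import structures.
From mathcomp Require Import all_boot all_order all_algebra.
From mathcomp Require Import ring lra.
From mathcomp Require Import all_classical all_reals all_analysis.
Import Order.TTheory GRing.Theory Num.Theory.
Import numFieldNormedType.Exports.
Local Open Scope classical_set_scope.
Local Open Scope ring_scope.

Set Implicit Arguments.
Unset Strict Implicit.
Unset Printing Implicit Defensive.

(** * Calculus in one variable *)

(** Two definitions shape the argument. [dn_operator] selects both a harmonic extension and a value
    of its normal derivative by [get], so an explicit series computes it only once extensions are
    unique and the value does not depend on the chart point. The length of the boundary is given by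
    some arc-length parametrisation, so such curves must be classified: on a circle of radius [r]
    they are locally [polar r (e * s / r + th)] with [e ^+ 2 = 1]. This reduces smoothness on either
    boundary to that of one function of a real variable, and it determines the radius.

    Series are never differentiated by a general theorem on limits: each term has a Taylor bound
    with quadratic remainder, valid up to the boundary circle, and these bounds are summed. Fourier
    inversion is likewise proved with explicit constants, from a double primitive of the Dirichlet
    kernel.

    The boundary isometry is the restriction of [cone_to_disk], which is injective on the whole
    orbit space. Hence every function on the cone is a pull-back from the plane, and eigenfunctions
    can be transported in both directions. *)

Section DerivativeRules.
Context {R : realType} {V : normedModType R}.
Implicit Types (f g : V -> R) (x v : V) (a b c : R).

(** The rules are restated for explicit lambda abstractions, with plain products as values, so that
    a combination of them is matched with the wanted derivative by [congr (is_derive _ _ _ _)] and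
    [ring]. *)
Lemma is_derive_addf f g x v a b : is_derive x v f a -> is_derive x v g b ->
  is_derive x v (fun y => f y + g y) (a + b).
Proof. exact: is_deriveD. Qed.

Lemma is_derive_oppf f x v a : is_derive x v f a ->
  is_derive x v (fun y => - f y) (- a).
Proof. exact: is_deriveN. Qed.

Lemma is_derive_subf f g x v a b : is_derive x v f a -> is_derive x v g b ->
  is_derive x v (fun y => f y - g y) (a - b).
Proof. exact: is_deriveB. Qed.

Lemma is_derive_mulf f g x v a b : is_derive x v f a -> is_derive x v g b ->
  is_derive x v (fun y => f y * g y) (a * g x + f x * b).
Proof.
move=> fa gb; rewrite addrC [a * _]mulrC.
exact: (@is_deriveM _ _ f g x v a b fa gb).
Qed.

Lemma is_derive_constf c x v : is_derive x v (fun=> c) 0.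
Proof. exact: is_derive_cst. Qed.

Lemma is_derive_scalef c f x v a : is_derive x v f a ->
  is_derive x v (fun y => c * f y) (c * a).
Proof. exact: is_deriveZ. Qed.

Lemma is_derive_sumf (F : nat -> V -> R) (dF : nat -> R) m n x v :
  (forall i, is_derive x v (F i) (dF i)) ->
  is_derive x v (fun y => \sum_(m <= i < n) F i y) (\sum_(m <= i < n) dF i).
Proof.
move=> FdF; elim: n => [|n IH].
  rewrite big_geq //.
  rewrite (_ : (fun _ => _) = cst 0); last by apply/funext => y; rewrite big_geq.
  exact: is_derive_cst.
have [mn|nm] := leqP m n; last first.
  rewrite big_geq //.
  rewrite (_ : (fun _ => _) = cst 0); last by apply/funext => y; rewrite big_geq.
  exact: is_derive_cst.
rewrite big_nat_recr //=.
rewrite (_ : (fun _ => _) = (fun y => \sum_(m <= i < n) F i y + F n y)); last first.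
  by apply/funext => y; rewrite big_nat_recr.
exact: is_derive_addf.
Qed.

End DerivativeRules.

Section RealCalculus.
Context {R : realType}.
Implicit Types (f g df : R -> R) (a b c x K : R).

Lemma is_derive_compf f g x a b : is_derive (g x) (1 : R) f a ->
  is_derive x (1 : R) g b -> is_derive x (1 : R) (fun y => f (g y)) (a * b).
Proof. exact: is_derive1_comp. Qed.

Lemma is_derive_idf x : is_derive x (1 : R) (fun y : R => y) 1.
Proof. exact: is_derive_id. Qed.

Lemma is_derive_affine c b x : is_derive x (1 : R) (fun y : R => c * y + b) c.
Proof. by apply: is_derive_eq; rewrite addr0 /GRing.scale /= mulr1. Qed.

Lemma is_derive_cos_affine c b x :
  is_derive x (1 : R) (fun y : R => cos (c * y + b)) (- c * sin (c * x + b)).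
Proof.
have H := is_derive_affine c b x.
rewrite (_ : - c * _ = - sin (c * x + b) * c); last by ring.
exact: (@is_derive_compf cos _ _ _ _ _ H).
Qed.

Lemma is_derive_sin_affine c b x :
  is_derive x (1 : R) (fun y : R => sin (c * y + b)) (c * cos (c * x + b)).
Proof.
have H := is_derive_affine c b x.
rewrite mulrC; exact: (@is_derive_compf sin _ _ _ _ _ H).
Qed.

Lemma is_derive_continuous f x a : is_derive x (1 : R) f a -> {for x, continuous f}.
Proof.
by move=> [fx _]; apply: differentiable_continuous; exact/derivable1_diffP.
Qed.

Lemma continuous_sumf (F : nat -> R -> R) m n : (forall i, continuous (F i)) ->
  continuous (fun y => \sum_(m <= i < n) F i y).
Proof.
move=> cF; rewrite (_ : (fun _ => _) = \sum_(m <= i < n) F i); last first.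
  by apply/funext => y; rewrite fct_sumE.
elim/big_ind: _ => [|f g cf cg|i _]; last exact: cF.
- exact: cst_continuous.
- by move=> x; apply: continuousD; [exact: cf|exact: cg].
Qed.

(** The minimum and maximum make the bound insensitive to the order of the end points. With [K = 0]
    it serves throughout as the criterion for a function to be constant. *)
Lemma mean_value_bound f df a b K :
  (forall x, Num.min a b <= x <= Num.max a b -> is_derive x (1 : R) f (df x)) ->
  (forall x, Num.min a b < x < Num.max a b -> `|df x| <= K) ->
  `|f b - f a| <= K * `|b - a|.
Proof.
move=> fdf dfK; wlog ab : a b fdf dfK / a <= b => [H|].
  have [ab|/ltW ba] := leP a b; first exact: (H a b fdf dfK ab).
  by rewrite distrC [`|b - a|]distrC; apply: (H b a _ _ ba); rewrite minC maxC.
move: fdf dfK; rewrite min_l // max_r // => fdf dfK.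
move: ab; rewrite le_eqVlt => /orP[/eqP->|ab]; first by rewrite !subrr !normr0 mulr0.
have [x|x|c] := @MVT R f df a b ab.
- by rewrite in_itv /= => /andP[ax xb]; apply: fdf; rewrite !ltW.
- apply: derivable_within_continuous => y; rewrite in_itv /= => yab.
  by case: (fdf y yab).
rewrite in_itv /= => cab ->; rewrite normrM ler_wpM2r //; exact: dfK.
Qed.

End RealCalculus.

(** * Integrals over one period *)

Section Integral.
Context {R : realType}.
Implicit Types (f g F : R -> R) (x K : R).

(* The lower bound [-1] leaves room for two-sided derivatives on [0, +oo[. *)
Definition primitive f x : R := parameterized_integral lebesgue_measure (-1) x f.

(* The integral of f over [0, 2 pi]. *)
Definition period_integral f : R := primitive f (2 * pi) - primitive f 0.

Lemma is_derive_primitive f x : continuous f -> -1 < x ->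
  is_derive x (1 : R) (primitive f) (f x).
Proof.
move=> cf x1.
have [||d e] := @continuous_FTC1_closed R f (-1) x (x + 1) _ _ x1 (cf x).
- by rewrite ltrDl.
- apply: continuous_compact_integrable; first exact: segment_compact.
  exact: continuous_subspaceT.
- apply: DeriveDef; [exact: d|by rewrite -derive1E; exact: e].
Qed.

(** [primitive f - F] has derivative 0 on the closed interval, hence is constant. Linearity and
    translation invariance of the integral are then obtained by exhibiting antiderivatives. *)
Lemma period_integralE f F : continuous f ->
  (forall x, 0 <= x <= 2 * pi -> is_derive x (1 : R) F (f x)) ->
  period_integral f = F (2 * pi) - F 0.
Proof.
move=> cf FF; apply/eqP; rewrite -subr_eq0 -normr_le0.
rewrite (_ : _ - _ = (primitive f (2 * pi) - F (2 * pi)) - (primitive f 0 - F 0)); last first.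
  by rewrite /period_integral; ring.
have pi2 : 0 <= 2 * pi :> R by rewrite mulr_ge0 // pi_ge0.
apply: (@le_trans _ _ (0 * `|2 * pi - 0|)); last by rewrite mul0r.
apply: (@mean_value_bound _ (fun x => primitive f x - F x) (fun x => f x - f x)).
  move=> x; rewrite min_l // max_r // => x02; apply: is_derive_subf; last exact: FF.
  by apply: is_derive_primitive => //; case/andP: x02 => x0 _; exact: lt_le_trans (ltrN10 R) x0.
by move=> x _; rewrite subrr normr0.
Qed.

Lemma period_integral_bound f K : continuous f ->
  (forall x, 0 < x < 2 * pi -> `|f x| <= K) ->
  `|period_integral f| <= K * (2 * pi).
Proof.
move=> cf fK; have pi2 : 0 <= 2 * pi :> R by rewrite mulr_ge0 // pi_ge0.
rewrite -[X in _ <= _ * X](ger0_norm pi2) -[X in _ <= _ * `|X|]subr0.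
apply: (@mean_value_bound _ _ f); rewrite min_l // max_r // => x /andP[x0 _].
by apply: is_derive_primitive => //; exact: lt_le_trans (ltrN10 R) x0.
Qed.

Lemma period_integralD f g : continuous f -> continuous g ->
  period_integral (fun x => f x + g x) = period_integral f + period_integral g.
Proof.
move=> cf cg; rewrite [LHS](@period_integralE _ (fun x => primitive f x + primitive g x)).
- by rewrite /period_integral; ring.
- by move=> x; apply: continuousD; [exact: cf|exact: cg].
move=> x /andP[x0 _]; have x1 : -1 < x := lt_le_trans (ltrN10 R) x0.
by apply: is_derive_addf; exact: is_derive_primitive.
Qed.

Lemma period_integralZ c f : continuous f ->
  period_integral (fun x => c * f x) = c * period_integral f.
Proof.
move=> cf; rewrite [LHS](@period_integralE _ (fun x => c * primitive f x)).
- by rewrite /period_integral; ring.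
- by move=> x; apply: continuousM; [exact: cvg_cst|exact: cf].
move=> x /andP[x0 _]; have x1 : -1 < x := lt_le_trans (ltrN10 R) x0.
by apply: is_derive_scalef; exact: is_derive_primitive.
Qed.

Lemma period_integral_sum (F : nat -> R -> R) m n : (forall i, continuous (F i)) ->
  period_integral (fun x => \sum_(m <= i < n) F i x) =
  \sum_(m <= i < n) period_integral (F i).
Proof.
move=> cF.
rewrite [LHS](@period_integralE _ (fun x => \sum_(m <= i < n) primitive (F i) x)).
- by rewrite -sumrB.
- exact: continuous_sumf.
move=> x /andP[x0 _]; have x1 : -1 < x := lt_le_trans (ltrN10 R) x0.
by apply: is_derive_sumf => i; exact: is_derive_primitive.
Qed.

Lemma is_derive_translate f a x d : is_derive (x + a) (1 : R) f d ->
  is_derive x (1 : R) (fun t => f (t + a)) d.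
Proof.
have G : is_derive x (1 : R) (fun t => t + a) 1.
  by apply: is_derive_eq; rewrite addr0.
by move=> H; rewrite -[d]mulr1; exact: (@is_derive_compf _ f (fun t => t + a) _ _ _ H G).
Qed.

(** The integral over [[x, x + 2 pi]] has derivative [f (x + 2 pi) - f x = 0] in [x]. The condition
    [0 <= x] keeps every point to the right of the base point [-1]. *)
Lemma period_integral_shift f x : continuous f -> (forall t, f (t + 2 * pi) = f t) ->
  0 <= x -> period_integral (fun t => f (t + x)) = period_integral f.
Proof.
move=> cf pf x0; have pi0 : 0 <= 2 * pi :> R by rewrite mulr_ge0 // pi_ge0.
rewrite [LHS](@period_integralE _ (fun t => primitive f (t + x))).
- apply/eqP; rewrite -subr_eq0 -normr_le0.
  apply: (@le_trans _ _ (0 * `|x - 0|)); last by rewrite mul0r.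
  rewrite add0r [2 * pi + x]addrC /period_integral.
  rewrite -[X in primitive f X - primitive f 0]add0r.
  apply: (@mean_value_bound _ (fun t => primitive f (t + 2 * pi) - primitive f t)
    (fun t => f (t + 2 * pi) - f t)); last first.
    by move=> t _; rewrite pf subrr normr0.
  move=> t; rewrite min_l // max_r // => /andP[t0 _].
  have t1 : -1 < t := lt_le_trans (ltrN10 R) t0.
  apply: is_derive_subf; last exact: is_derive_primitive.
  apply: is_derive_translate; apply: is_derive_primitive => //.
  by rewrite (lt_le_trans t1) // lerDl.
- move=> t; apply: (@continuous_comp _ _ _ (fun t => t + x) f); last exact: cf.
  by apply: continuousD; [exact: cvg_id|exact: cvg_cst].
move=> t /andP[t0 _]; apply: is_derive_translate; apply: is_derive_primitive => //.
by rewrite (lt_le_trans (ltrN10 R)) // addr_ge0.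
Qed.

End Integral.

(** * Fourier series of smooth periodic functions *)

Section Dirichlet.
Context {R : realType}.
Implicit Types (N M n : nat) (t x : R).

Lemma sin_natpi n : sin (n%:R * pi) = 0 :> R.
Proof.
elim: n => [|n IH]; first by rewrite mul0r sin0.
by rewrite -natr1 mulrDl mul1r sinDpi IH oppr0.
Qed.

Lemma cos_nat2pi n t : cos (n%:R * (t + 2 * pi)) = cos (n%:R * t) :> R.
Proof.
rewrite mulrDr (_ : n%:R * (2 * pi) = pi *+ 2 *+ n); last first.
  by rewrite -[RHS]mulr_natl -[pi *+ 2]mulr_natl.
exact: (periodicn (@cosD2pi R)).
Qed.

Lemma sin_nat2pi n t : sin (n%:R * (t + 2 * pi)) = sin (n%:R * t) :> R.
Proof.
rewrite mulrDr (_ : n%:R * (2 * pi) = pi *+ 2 *+ n); last first.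
  by rewrite -[RHS]mulr_natl -[pi *+ 2]mulr_natl.
exact: (periodicn (@sinD2pi R)).
Qed.

Definition dirichlet N t : R := 2^-1 + \sum_(0 <= n < N) cos (n.+1%:R * t).

(** Partial sums of the Fourier series of [(pi - t) / 2] on []0, 2 pi[]. *)
Definition sawtooth N t : R := \sum_(0 <= n < N) n.+1%:R^-1 * sin (n.+1%:R * t).

(** Partial sums of the Fourier series of [(t - pi)^2 / 4] on [[0, 2 pi]], up to an additive
    constant. Below, [parabola N pi] stands in for that constant, so that [- pi^2 / 12] need not be
    computed. *)
Definition parabola N t : R :=
  \sum_(0 <= n < N) n.+1%:R^-2 * cos (n.+1%:R * t).

(** The sum telescopes: [2 sin (t / 2) cos (n t)] is the difference of [sin ((n + 1/2) t)] and
    [sin ((n - 1/2) t)]. *)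
Lemma dirichletE N t : 2 * sin (t / 2) * dirichlet N t = sin ((N%:R + 2^-1) * t).
Proof.
elim: N => [|N IH].
  by rewrite /dirichlet big_geq // addr0 add0r [t / 2]mulrC; field.
have -> : dirichlet N.+1 t = dirichlet N t + cos (N.+1%:R * t).
  by rewrite /dirichlet big_nat_recr //= addrA.
rewrite mulrDr IH.
have -> : (N%:R + 2^-1) * t = N.+1%:R * t - t / 2 by rewrite -natr1; field.
have -> : (N.+1%:R + 2^-1) * t = N.+1%:R * t + t / 2 by field.
rewrite sinB sinD; ring.
Qed.

Lemma is_derive_sin_scale (c t : R) :
  is_derive t (1 : R) (fun y : R => sin (c * y)) (c * cos (c * t)).
Proof.
have := is_derive_sin_affine c 0 t; rewrite addr0.
by under eq_fun do rewrite addr0.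
Qed.

Lemma is_derive_cos_scale (c t : R) :
  is_derive t (1 : R) (fun y : R => cos (c * y)) (- c * sin (c * t)).
Proof.
have := is_derive_cos_affine c 0 t; rewrite addr0.
by under eq_fun do rewrite addr0.
Qed.

Lemma is_derive_sawtooth N t :
  is_derive t (1 : R) (sawtooth N) (dirichlet N t - 2^-1).
Proof.
rewrite /dirichlet addrC addKr; apply: is_derive_sumf => n.
rewrite -[X in is_derive _ _ _ X](mulKf (_ : n.+1%:R != 0)) ?pnatr_eq0 //.
by apply: is_derive_scalef; exact: is_derive_sin_scale.
Qed.

Lemma is_derive_parabola N t :
  is_derive t (1 : R) (parabola N) (- sawtooth N t).
Proof.
rewrite /sawtooth -sumrN; apply: is_derive_sumf => n.
rewrite (_ : - _ = n.+1%:R^-2 * (- n.+1%:R * sin (n.+1%:R * t))); last first.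
  by field; rewrite addrC natr1 pnatr_eq0.
by apply: is_derive_scalef; exact: is_derive_cos_scale.
Qed.

(** [sin (z / 2) = cos (|pi - z| / 2)] decreases with the distance from [z] to [pi], and [y] lies
    between [t] and [pi]. *)
Lemma sin_half_mono t y : 0 < t < 2 * pi ->
  Num.min t pi <= y <= Num.max t pi -> sin (t / 2) <= sin (y / 2).
Proof.
move=> /andP[t0 t2] yt; have pi0 := pi_gt0 R.
have E z : sin (z / 2) = cos (`|pi - z| / 2).
  rewrite -[RHS]cos_norm normrM normr_id -normrM cos_norm.
  rewrite (_ : (pi - z) / 2 = pi / 2 - z / 2); last by field.
  by rewrite cosB cos_pihalf sin_pihalf mul0r mul1r add0r.
rewrite !E.
have yt' : `|pi - y| <= `|pi - t|.
  by move: yt; case: (leP t pi) => tp; rewrite ?ler_norml; case/andP => y1 y2;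
    [rewrite [`|pi - t|]ger0_norm ?subr_ge0 //|
     rewrite [`|pi - t|]ltr0_norm ?subr_lt0 //]; apply/andP; split; lra.
have tpi : `|pi - t| <= pi by rewrite ler_norml; apply/andP; split; lra.
rewrite le_eqVlt; move: yt'; rewrite le_eqVlt => /orP[/eqP->|yt']; first by rewrite eqxx.
apply/orP; right; rewrite ltr_cos ?in_itv /=; first by lra.
- by apply/andP; split; [rewrite divr_ge0|lra].
- by apply/andP; split; [rewrite divr_ge0|lra].
Qed.

(** With [m = N + 1/2], the first difference has derivative [sin (m t) / (2 sin (t / 2))], which
    oscillates but is not small. One integration by parts produces the last term and leaves a
    derivative with a factor [1 / m]. *)
Let G N t := sawtooth N t - (pi - t) / 2 +
  (2 * (N%:R + 2^-1))^-1 * (cos ((N%:R + 2^-1) * t) / sin (2^-1 * t)).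

Let is_derive_G N t : sin (2^-1 * t) != 0 ->
  is_derive t (1 : R) (G N) (- (4 * (N%:R + 2^-1))^-1 *
    (cos ((N%:R + 2^-1) * t) * cos (2^-1 * t) / sin (2^-1 * t) ^+ 2)).
Proof.
move=> s0; have m0 : N%:R + 2^-1 != 0 :> R by rewrite gt_eqF // ltr_wpDl // ler0n.
have D1 := is_derive_sawtooth N t.
have D2 : is_derive t (1 : R) (fun t => (pi - t) / 2) (- 2^-1).
  by apply: is_derive_eq; rewrite /GRing.scale /=; ring.
have D3 := is_derive_cos_scale (N%:R + 2^-1) t.
have D4 := is_deriveV s0 (is_derive_sin_scale 2^-1 t).
have D5 := is_derive_scalef (2 * (N%:R + 2^-1))^-1 (is_derive_mulf D3 D4).
have D := is_derive_addf (is_derive_subf D1 D2) D5.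
have E := dirichletE N t.
move: D; congr (is_derive _ _ _ _).
rewrite /GRing.scale /= -E [t / 2]mulrC; field.
by rewrite s0 gt_eqF // ltr_wpDl // mulr_ge0 // ler0n.
Qed.

(* Up to the correction cos ((N + 1/2) t) / ((2 N + 1) sin (t / 2)), the error has
   derivative O(1 / N) by the closed form of the Dirichlet kernel. *)
Lemma sawtooth_bound t : 0 < t < 2 * pi -> exists C, forall N y,
  Num.min t pi <= y <= Num.max t pi ->
  `|sawtooth N y - (pi - y) / 2| <= C / (N%:R + 2^-1).
Proof.
move=> t02; have pi0 := pi_gt0 R.
set s := sin (t / 2).
have s0 : 0 < s by apply: sin_gt0_pi; apply/andP; split; lra.
(* [pi / (4 s^2)] bounds the variation of [G N] between [y] and [pi]. The correction term at [y] and
   the value [G N pi], where all sines of the sum vanish, contribute [s^-1 / 2] each. *)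
exists (pi / (4 * s ^+ 2) + s^-1) => N y yt.
have m0 : 0 < N%:R + 2^-1 :> R by rewrite ltr_wpDl // ler0n.
have mi (c : R) : 0 <= c -> 0 <= (c * (N%:R + 2^-1))^-1.
  by move=> c0; rewrite invr_ge0 mulr_ge0 // ltW.
have y02 : 0 < y < 2 * pi.
  by move: yt t02; case: (leP t pi) => _ /andP[? ?] /andP[? ?];
    apply/andP; split; lra.
have sle z : Num.min y pi <= z <= Num.max y pi -> s <= sin (2^-1 * z).
  move=> zy; rewrite mulrC; apply: le_trans (sin_half_mono t02 yt) _.
  exact: sin_half_mono.
have Gpi : G N pi = (2 * (N%:R + 2^-1))^-1 * cos ((N%:R + 2^-1) * pi).
  rewrite /G subrr mul0r subr0 [2^-1 * pi]mulrC sin_pihalf divr1.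
  rewrite [sawtooth _ _]big1 ?add0r // => n _.
  by rewrite sin_natpi mulr0.
have dG : `|G N y - G N pi| <= (4 * (N%:R + 2^-1))^-1 * s ^- 2 * pi.
  apply: (@le_trans _ _ ((4 * (N%:R + 2^-1))^-1 * s ^- 2 * `|y - pi|)); last first.
    rewrite ler_wpM2l //; first by rewrite mulr_ge0 // invr_ge0 ?exprn_ge0 ?mulr_ge0 // ltW.
    by rewrite ler_norml; apply/andP; split; lra.
  apply: mean_value_bound => z.
    rewrite minC maxC => zy; apply: is_derive_G.
    by rewrite gt_eqF // (lt_le_trans s0) // sle.
  rewrite minC maxC => /andP[zy1 zy2].
  have sz : s <= sin (2^-1 * z) by apply: sle; rewrite !ltW.
  rewrite normrM normrN (ger0_norm (mi _ (ler0n _ 4))).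
  rewrite ler_wpM2l ?mi //.
  rewrite !normrM -[s ^- 2]mul1r ler_pM // ?mulr_ge0 //.
    by rewrite -[leRHS]mulr1 ler_pM // cos_max.
  rewrite normfV normrX lef_pV2 ?posrE ?exprn_gt0 ?normr_gt0 //; last first.
  - by rewrite gt_eqF // (lt_le_trans s0).
  by rewrite lerXn2r ?nnegrE // ?(ltW s0) // ger0_norm // ltW // (lt_le_trans s0).
have sy : s <= sin (2^-1 * y).
  by apply: sle; case: (leP y pi) => // yp; rewrite lexx ?(ltW yp) // yp.
have tail c : `|(2 * (N%:R + 2^-1))^-1 * (cos c / sin (2^-1 * y))| <=
    (2 * (N%:R + 2^-1))^-1 * s^-1.
  rewrite normrM (ger0_norm (mi _ (ler0n _ 2))).
  rewrite ler_wpM2l ?mi //.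
  rewrite normrM -[leRHS]mul1r ler_pM ?cos_max // normfV lef_pV2 ?posrE //.
    by rewrite ger0_norm // ltW // (lt_le_trans s0).
  by rewrite normr_gt0 gt_eqF // (lt_le_trans s0).
have -> : sawtooth N y - (pi - y) / 2 = (G N y - G N pi) + G N pi -
  (2 * (N%:R + 2^-1))^-1 * (cos ((N%:R + 2^-1) * y) / sin (2^-1 * y)).
  by rewrite subrK /G addrK.
apply: le_trans (ler_normB _ _) _.
apply: le_trans (lerD (ler_normD _ _) (tail _)) _.
apply: (@le_trans _ _ ((4 * (N%:R + 2^-1))^-1 * s ^- 2 * pi +
  (2 * (N%:R + 2^-1))^-1 * s^-1 + (2 * (N%:R + 2^-1))^-1 * s^-1)).
  rewrite lerD2r lerD // Gpi normrM (ger0_norm (mi _ (ler0n _ 2))).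
  rewrite ler_wpM2l ?mi //.
  by apply: le_trans (cos_max _) _; rewrite invf_ge1 // sin_le1.
rewrite le_eqVlt; apply/orP; left; apply/eqP; field.
by rewrite (gt_eqF s0) gt_eqF // ltr_wpDl // mulr_ge0 // ler0n.
Qed.

(** Comparison with a telescoping sum: [1 / (n + 1)^2 <= 1 / n - 1 / (n + 1)]. *)
Lemma parabola_tail N M t : (0 < N)%N -> (N <= M)%N ->
  `|parabola M t - parabola N t| <= N%:R^-1.
Proof.
move=> N0 NM; rewrite /parabola (big_cat_nat (leq0n N) NM) /= addrAC subrr add0r.
apply: le_trans (ler_norm_sum _ _ _) _.
apply: (@le_trans _ _ (\sum_(N <= n < M) (n%:R^-1 - n.+1%:R^-1))).
  rewrite !big_nat; apply: ler_sum => n /andP[Nn _].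
  rewrite normrM -[leRHS]mulr1 ler_pM // ?cos_max // ger0_norm ?invr_ge0 ?exprn_ge0 //.
  have n0 : 0 < n%:R :> R by rewrite ltr0n (leq_trans N0).
  have n1 : 0 < n.+1%:R :> R by rewrite ltr0n.
  rewrite (_ : n%:R^-1 - _ = (n%:R * n.+1%:R)^-1).
    by rewrite lef_pV2 ?posrE ?exprn_gt0 ?mulr_gt0 // expr2 ler_wpM2r // ?ler_nat // ltW.
  by rewrite -natr1; field; rewrite natr1 !gt_eqF.
have T : \sum_(N <= n < M) (n%:R^-1 - n.+1%:R^-1 : R) = N%:R^-1 - M%:R^-1.
  under eq_bigr do rewrite -opprB; rewrite sumrN.
  by rewrite (telescope_sumr (fun n => n%:R^-1 : R) NM) opprB.
by rewrite T lerBlDr lerDl invr_ge0 ler0n.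
Qed.

(* R_N = parabola N - (t - pi)^2 / 4 has derivative (pi - t) / 2 - sawtooth N, which
   tends to 0 locally uniformly on ]0, 2 pi[; the tail bound on parabola M -
   parabola N makes the estimate uniform up to the end points. *)
Lemma parabola_approx N t : (0 < N)%N -> 0 < t < 2 * pi ->
  `|parabola N t - (t - pi) ^+ 2 / 4 - parabola N pi| <= 2 / N%:R.
Proof.
move=> N0 t02; have pi0 := pi_gt0 R.
have [C CP] := sawtooth_bound t02.
have C0 : 0 <= C.
  have := le_trans (normr_ge0 _) (CP 0%N t _).
  rewrite pmulr_lge0 ?invr_gt0 ?add0r //; apply.
  by case: (leP t pi) => // tp; rewrite lexx ?(ltW tp) // tp.
have B M : `|(parabola M t - (t - pi) ^+ 2 / 4) - (parabola M pi - (pi - pi) ^+ 2 / 4)|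
    <= C / (M%:R + 2^-1) * pi.
  apply: (@le_trans _ _ (C / (M%:R + 2^-1) * `|t - pi|)); last first.
    rewrite ler_wpM2l //; first by rewrite divr_ge0 // addr_ge0.
    by rewrite ler_norml; apply/andP; split; lra.
  apply: (@mean_value_bound _ (fun t => parabola M t - (t - pi) ^+ 2 / 4)
    (fun t => - sawtooth M t - (t - pi) / 2)) => y.
    move=> _; apply: is_derive_subf; first exact: is_derive_parabola.
    by apply: is_derive_eq; rewrite /GRing.scale /=; field.
  move=> /andP[y1 y2]; rewrite -normrN opprB opprK.
  rewrite (_ : (y - pi) / 2 + _ = sawtooth M y - (pi - y) / 2); last by field.
  by apply: CP; rewrite minC maxC !ltW.
apply/ler_addgt0Pr => e e0.
(* [C] depends on [t]. Choosing [M] after [t] and [e] makes its contribution at most [e]; what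
   remains are two tails of size [1 / N], uniform in [t]. *)
pose M := (N + Num.truncn (C * pi / e)).+1.
have NM : (N <= M)%N by rewrite /M -addnS leq_addr.
have M0 : (0 : R) < M%:R by rewrite ltr0n.
have -> : parabola N t - (t - pi) ^+ 2 / 4 - parabola N pi =
  ((parabola M t - (t - pi) ^+ 2 / 4) - (parabola M pi - (pi - pi) ^+ 2 / 4))
  - (parabola M t - parabola N t) + (parabola M pi - parabola N pi).
  by rewrite subrr expr0n /= mul0r subr0; ring.
apply: le_trans (ler_normD _ _) _.
apply: le_trans (lerD (ler_normB _ _) (lexx _)) _.
have H1 := parabola_tail t N0 NM.
have H2 := parabola_tail pi N0 NM.
apply: le_trans (lerD (lerD (B M) H1) H2) _.
rewrite (_ : 2 / N%:R + e = e + N%:R^-1 + N%:R^-1); last first.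
  by field; rewrite pnatr_eq0 -lt0n.
rewrite !lerD2r mulrAC ler_pdivrMr; last by rewrite ltr_wpDr.
rewrite -ler_pdivrMl // mulrC.
have MT : C * pi / e <= M%:R.
  apply: le_trans (ltW (truncnS_gt _)) _.
  by rewrite ler_nat /M ltnS leq_addl.
by rewrite (le_trans MT) // lerDl.
Qed.

End Dirichlet.

(** * Convergence of the series and decay of the coefficients *)

Section Fourier.
Context {R : realType}.
Implicit Types (v : R -> R) (x t : R).

Definition periodic2pi v := forall t, v (t + 2 * pi) = v t.

Let fourier_cos v n := period_integral (fun t => v t * cos (n%:R * t)).
Let fourier_sin v n := period_integral (fun t => v t * sin (n%:R * t)).

Let continuous_mul (f g : R -> R) : continuous f -> continuous g ->
  continuous (fun t => f t * g t).
Proof. by move=> cf cg t; apply: continuousM; [exact: cf|exact: cg]. Qed.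

Let continuous_add (f g : R -> R) : continuous f -> continuous g ->
  continuous (fun t => f t + g t).
Proof. by move=> cf cg t; apply: continuousD; [exact: cf|exact: cg]. Qed.

Let continuous_cosn (c : R) : continuous (fun t : R => cos (c * t)).
Proof. by move=> t; exact: is_derive_continuous (is_derive_cos_scale _ _). Qed.

Let continuous_sinn (c : R) : continuous (fun t : R => sin (c * t)).
Proof. by move=> t; exact: is_derive_continuous (is_derive_sin_scale _ _). Qed.

Let continuous_shift (f : R -> R) x : continuous f -> continuous (fun t => f (t + x)).
Proof.
move=> cf t; apply: (@continuous_comp _ _ _ (fun t => t + x) f); last exact: cf.
by apply: continuousD; [exact: cvg_id|exact: cvg_cst].
Qed.

Lemma continuous_compact_bound (f : R -> R) (a b : R) : continuous f ->
  exists K, forall t, a < t < b -> `|f t| <= K.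
Proof.
move=> cf; have [ab|ba] := leP a b; last first.
  by exists 0 => t /andP[at_ tb]; have := lt_trans at_ (lt_trans tb ba); rewrite ltxx.
have cn : {within `[a, b], continuous (fun t => `|f t|)}.
  apply: continuous_subspaceT => t; apply: (@continuous_comp _ _ _ f); first exact: cf.
  exact: norm_continuous.
have [c _ cP] := EVT_max ab cn.
by exists `|f c| => t /andP[? ?]; apply: cP; rewrite in_itv /= !ltW.
Qed.

(* Integration by parts against a double primitive of the Dirichlet kernel
   that tends to 0 uniformly. *)
Lemma dirichlet_integral v v1 v2 x N :
  (forall t, is_derive t (1 : R) v (v1 t)) ->
  (forall t, is_derive t (1 : R) v1 (v2 t)) ->
  continuous v2 -> periodic2pi v -> periodic2pi v1 ->
  period_integral (fun t => v (t + x) * dirichlet N t) - pi * v x =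
  - period_integral (fun t => v2 (t + x) *
      (parabola N t - (t - pi) ^+ 2 / 4 - parabola N pi)).
Proof.
move=> dv dv1 cv2 pv pv1.
pose r t := parabola N t - (t - pi) ^+ 2 / 4 - parabola N pi.
pose r1 t := (pi - t) / 2 - sawtooth N t.
have dr t : is_derive t (1 : R) r (r1 t).
  have D := is_derive_parabola N t.
  by apply: is_derive_eq; rewrite /GRing.scale /= /r1; field.
have dr1 t : is_derive t (1 : R) r1 (- dirichlet N t).
  have D := is_derive_sawtooth N t.
  by apply: is_derive_eq; rewrite /GRing.scale /=; field.
have cont (f g : R -> R) : (forall t, is_derive t (1 : R) f (g t)) -> continuous f.
  by move=> fg t; exact: is_derive_continuous (fg t).
have cD : continuous (dirichlet N : R -> R).
  rewrite /dirichlet; apply: continuous_add; first exact: cst_continuous.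
  by apply: continuous_sumf => i; exact: continuous_cosn.
apply/eqP; rewrite -addr_eq0 addrAC subr_eq0; apply/eqP.
rewrite -period_integralD; last 2 first.
- by apply: continuous_mul => //; apply: continuous_shift; exact: cont dv.
- apply: continuous_mul; first exact: continuous_shift.
  exact: cont dr.
(* The end-point terms with [v1] cancel, since [r] takes the same value at 0 and [2 pi]. The
   function [r1] passes from [pi / 2] to [- pi / 2], which produces [pi * v x]. *)
rewrite [LHS](@period_integralE _ _ (fun t => v1 (t + x) * r t - v (t + x) * r1 t)).
- rewrite add0r (addrC (2 * pi)) pv pv1 /r /r1 /sawtooth /parabola.
  have -> : \sum_(0 <= n < N) n.+1%:R^-1 * sin (n.+1%:R * (2 * pi)) = 0 :> R.
    by rewrite big1 // => n _; rewrite -[2 * pi]add0r sin_nat2pi mulr0 sin0 mulr0.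
  have -> : \sum_(0 <= n < N) n.+1%:R^-1 * sin (n.+1%:R * 0) = 0 :> R.
    by rewrite big1 // => n _; rewrite mulr0 sin0 mulr0.
  have -> : \sum_(0 <= n < N) n.+1%:R^-2 * cos (n.+1%:R * (2 * pi)) =
            \sum_(0 <= n < N) n.+1%:R^-2 * cos (n.+1%:R * 0) :> R.
    by apply: eq_bigr => n _; rewrite -[2 * pi]add0r cos_nat2pi.
  by field.
- apply: continuous_add.
    by apply: continuous_mul => //; apply: continuous_shift; exact: cont dv.
  apply: continuous_mul; first exact: continuous_shift.
  exact: cont dr.
move=> t _; have D1 := is_derive_translate (dv (t + x)).
have D2 := is_derive_translate (dv1 (t + x)).
have := is_derive_subf (is_derive_mulf D2 (dr t)) (is_derive_mulf D1 (dr1 t)).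
by congr (is_derive _ _ _ _); rewrite /r; ring.
Qed.

Lemma dirichlet_integral_cvg v v1 v2 x :
  (forall t, is_derive t (1 : R) v (v1 t)) ->
  (forall t, is_derive t (1 : R) v1 (v2 t)) ->
  continuous v2 -> periodic2pi v -> periodic2pi v1 ->
  period_integral (fun t => v (t + x) * dirichlet N t) @[N --> \oo] --> pi * v x.
Proof.
move=> dv dv1 cv2 pv pv1; have pi0 := pi_gt0 R.
have [K KP] := @continuous_compact_bound (fun t => v2 (t + x)) 0 (2 * pi)
  (continuous_shift cv2).
have K0 : 0 <= K by apply: le_trans (KP pi _) => //; apply/andP; split; lra.
apply/cvgrPdist_le => e e0; near=> N.
have N0 : (0 < N)%N by near: N; exact: nbhs_infty_gt.
rewrite distrC (dirichlet_integral _ _ dv dv1) // normrN.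
apply: (@le_trans _ _ (K * (2 / N%:R) * (2 * pi))).
  apply: period_integral_bound.
    apply: continuous_mul; first exact: continuous_shift.
    move=> t; apply: (@is_derive_continuous _ _ _ (- sawtooth N t - (t - pi) / 2)).
    have D := is_derive_parabola N t.
    by apply: is_derive_eq; rewrite /GRing.scale /=; field.
  by move=> t t02; rewrite normrM ler_pM // ?KP // parabola_approx.
rewrite (_ : _ * _ = K * 4 * pi / N%:R); last by field; rewrite pnatr_eq0 -lt0n.
rewrite ler_pdivrMr ?ltr0n // -ler_pdivrMl //.
by near: N; exact: nbhs_infty_ger.
Unshelve. all: by end_near. Qed.

(** Translation by [x] turns [v (t + x) cos (n t)] into [v t cos (n (t - x))], which the addition
    formula splits into the two coefficients. *)
Let dirichlet_integral_expand v x N : continuous v -> periodic2pi v -> 0 <= x ->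
  period_integral (fun t => v (t + x) * dirichlet N t) =
  2^-1 * period_integral v + \sum_(0 <= n < N)
    (fourier_cos v n.+1 * cos (n.+1%:R * x) + fourier_sin v n.+1 * sin (n.+1%:R * x)).
Proof.
move=> cv pv x0.
have cvx := continuous_shift (x := x) cv.
rewrite (_ : (fun t => _) = (fun t => 2^-1 * v (t + x) +
    \sum_(0 <= n < N) v (t + x) * cos (n.+1%:R * t))); last first.
  by apply/funext => t; rewrite /dirichlet mulrDr mulr_sumr [_ * 2^-1]mulrC.
rewrite period_integralD; last 2 first.
- by apply: continuous_mul => //; exact: cst_continuous.
- by apply: continuous_sumf => n; exact: continuous_mul.
rewrite period_integralZ // (period_integral_shift cv pv x0); congr (_ + _).
rewrite period_integral_sum; last by move=> n; exact: continuous_mul.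
apply: eq_bigr => n _; set c := n.+1%:R.
have cvc : continuous (fun t => v t * cos (c * t)) by exact: continuous_mul.
have cvs : continuous (fun t => v t * sin (c * t)) by exact: continuous_mul.
rewrite [LHS](_ : _ = period_integral (fun t => (fun t =>
    cos (c * x) * (v t * cos (c * t)) + sin (c * x) * (v t * sin (c * t))) (t + x))).
  rewrite (@period_integral_shift _ (fun t => cos (c * x) * (v t * cos (c * t)) +
    sin (c * x) * (v t * sin (c * t)))) //.
  - rewrite period_integralD; first last.
    + by apply: continuous_mul => //; exact: cst_continuous.
    + by apply: continuous_mul => //; exact: cst_continuous.
    by rewrite !period_integralZ // mulrC [sin _ * _]mulrC.
  - by apply: continuous_add; apply: continuous_mul => //; exact: cst_continuous.
  - by move=> t; rewrite pv cos_nat2pi sin_nat2pi.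
congr period_integral; apply/funext => t /=.
have -> : c * t = c * (t + x) - c * x by ring.
rewrite cosB; ring.
Qed.

Lemma fourier_cvg v v1 v2 x :
  (forall t, is_derive t (1 : R) v (v1 t)) ->
  (forall t, is_derive t (1 : R) v1 (v2 t)) ->
  continuous v2 -> periodic2pi v -> periodic2pi v1 ->
  series (fun n => (if n == 0%N then 2^-1 else 1) / pi *
    (fourier_cos v n * cos (n%:R * x) + fourier_sin v n * sin (n%:R * x))) @ \oo
  --> v x.
Proof.
move=> dv dv1 cv2 pv pv1.
have cv : continuous v by move=> t; exact: is_derive_continuous (dv t).
have pi0 : pi != 0 :> R by rewrite gt_eqF // pi_gt0.
pose T y (n : nat) := (if n == 0%N then 2^-1 else 1) / pi *
  (fourier_cos v n * cos (n%:R * y) + fourier_sin v n * sin (n%:R * y)).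
(* Both sides have period [2 pi] in [x], so [x] may be moved to the half-line on which translation
   invariance of the integral is available. *)
rewrite -/(T x); wlog x0 : x / 0 <= x => [H|].
  have P m : v (x + m%:R * (2 * pi)) = v x.
    elim: m => [|m IH]; first by rewrite mul0r addr0.
    by rewrite -natr1 mulrDl mul1r addrA pv.
  pose m := (Num.truncn (- x / (2 * pi))).+1.
  have xm : 0 <= x + m%:R * (2 * pi).
    have pi2 : 0 < 2 * pi :> R by rewrite mulr_gt0 // pi_gt0.
    rewrite -lerBlDl sub0r -ler_pdivrMr //; exact: ltW (truncnS_gt _).
  rewrite -(P m) (_ : T x = T (x + m%:R * (2 * pi))); first exact: H.
  apply/funext => n; rewrite /T.
  have C : (cos (n%:R * (x + m%:R * (2 * pi))) = cos (n%:R * x))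
        * (sin (n%:R * (x + m%:R * (2 * pi))) = sin (n%:R * x)).
    elim: {xm} m => [|m IH]; first by rewrite mul0r addr0.
    by rewrite -natr1 mulrDl mul1r addrA cos_nat2pi sin_nat2pi !IH.
  by rewrite !C.
(* [dirichlet N] carries the frequencies 0 to [N], that is [N + 1] terms of the series. *)
rewrite -(cvg_shiftS (series _)).
have H : pi^-1 * period_integral (fun t => v (t + x) * dirichlet N t)
    @[N --> \oo] --> pi^-1 * (pi * v x).
  by apply: cvgM; [exact: cvg_cst|exact: dirichlet_integral_cvg dv dv1 cv2 pv pv1].
rewrite mulKf // in H; apply: cvg_trans H; apply: near_eq_cvg; near=> N.
rewrite /= /T (dirichlet_integral_expand N cv pv x0) /series /= big_nat_recl //=.
rewrite !mul0r sin0 cos0 mulr0 mulr1 addr0 mulrDr mulr_sumr; congr (_ + _).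
  rewrite mulrA [pi^-1 * _]mulrC; congr (_ * period_integral _).
  by apply/funext => t; rewrite mul0r cos0 mulr1.
by apply: eq_bigr => n _; rewrite mul1r.
Unshelve. all: by end_near. Qed.

Let fourier_cos_derive v v1 n : (forall t, is_derive t (1 : R) v (v1 t)) ->
  continuous v1 -> periodic2pi v -> n%:R * fourier_cos v n = - fourier_sin v1 n.
Proof.
move=> dv cv1 pv; have cv : continuous v by move=> t; exact: is_derive_continuous (dv t).
apply/eqP; rewrite -addr_eq0 -period_integralZ; last exact: continuous_mul.
rewrite -period_integralD; [|by apply: continuous_mul; [exact: cst_continuous|exact: continuous_mul]
  |exact: continuous_mul].
apply/eqP; rewrite [LHS](@period_integralE _ _ (fun t => v t * sin (n%:R * t))).
- by rewrite -[2 * pi]add0r pv sin_nat2pi subrr.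
- by apply: continuous_add; do ?apply: continuous_mul => //; exact: cst_continuous.
move=> t _; have := is_derive_mulf (dv t) (is_derive_sin_scale n%:R t).
by congr (is_derive _ _ _ _); ring.
Qed.

Let fourier_sin_derive v v1 n : (forall t, is_derive t (1 : R) v (v1 t)) ->
  continuous v1 -> periodic2pi v -> n%:R * fourier_sin v n = fourier_cos v1 n.
Proof.
move=> dv cv1 pv; have cv : continuous v by move=> t; exact: is_derive_continuous (dv t).
apply/eqP; rewrite -subr_eq0 -mulN1r -!period_integralZ; [|exact: continuous_mul..].
rewrite -period_integralD; [|by apply: continuous_mul; [exact: cst_continuous|exact: continuous_mul]..].
apply/eqP; rewrite [LHS](@period_integralE _ _ (fun t => - (v t * cos (n%:R * t)))).
- by rewrite -[2 * pi]add0r pv cos_nat2pi subrr.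
- by apply: continuous_add; do ?apply: continuous_mul => //; exact: cst_continuous.
move=> t _; have := is_derive_oppf (is_derive_mulf (dv t) (is_derive_cos_scale n%:R t)).
by congr (is_derive _ _ _ _); ring.
Qed.

(** Integration by parts trades a factor [n] for a derivative and exchanges sine and cosine
    coefficients; the absolute values are summed so that the exchange does not matter to the
    induction. *)
Let fourier_decay (W : nat -> R -> R) j :
  (forall i t, is_derive t (1 : R) (W i) (W i.+1 t)) ->
  (forall i, periodic2pi (W i)) ->
  exists K, forall n, n%:R ^+ j * (`|fourier_cos (W 0%N) n| + `|fourier_sin (W 0%N) n|) <= K.
Proof.
elim: j W => [|j IH] W dW pW.
all: have cW i : continuous (W i) by move=> t; exact: is_derive_continuous (dW i t).
  have [K KP] := @continuous_compact_bound (W 0%N) 0 (2 * pi) (cW _).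
  exists (K * (2 * pi) + K * (2 * pi)) => n; rewrite expr0 mul1r lerD //.
    apply: period_integral_bound; first exact: continuous_mul.
    by move=> t /KP tK; rewrite normrM -[leRHS]mulr1 ler_pM // cos_max.
  apply: period_integral_bound; first exact: continuous_mul.
  by move=> t /KP tK; rewrite normrM -[leRHS]mulr1 ler_pM // sin_max.
have [K KP] := IH (fun i => W i.+1) (fun i => dW i.+1) (fun i => pW i.+1).
exists K => n; apply: le_trans (KP n).
rewrite exprSr -mulrA ler_wpM2l ?exprn_ge0 // mulrDr addrC.
rewrite -{1 2}(@ger0_norm _ n%:R) // -!normrM.
by rewrite (fourier_sin_derive _ (dW 0%N)) // (fourier_cos_derive _ (dW 0%N)) // normrN.
Qed.

(** [W] lists the successive derivatives of [W 0]. Convergence needs two of them, the decay at order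
    [j] needs [j]. *)
Theorem fourier_expansion (W : nat -> R -> R) :
  (forall i t, is_derive t (1 : R) (W i) (W i.+1 t)) ->
  (forall i, periodic2pi (W i)) ->
  exists a b : nat -> R,
    (forall j, exists K, forall n, n%:R ^+ j * (`|a n| + `|b n|) <= K) /\
    forall x, series (fun n => a n * cos (n%:R * x) + b n * sin (n%:R * x)) @ \oo
              --> W 0%N x.
Proof.
move=> dW pW; pose w n : R := (if n == 0%N then 2^-1 else 1) / pi.
exists (fun n => w n * fourier_cos (W 0%N) n), (fun n => w n * fourier_sin (W 0%N) n).
split=> [j|x].
  have [K KP] := fourier_decay j dW pW.
  have K0 : 0 <= K by apply: le_trans (KP 0%N); rewrite mulr_ge0 ?exprn_ge0 ?addr_ge0.
  exists (pi^-1 * K) => n.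
  have w0 : `|w n| <= pi^-1.
    rewrite normrM [X in _ * X]ger0_norm ?invr_ge0 ?pi_ge0 //.
    rewrite -[leRHS]mul1r ler_wpM2r ?invr_ge0 ?pi_ge0 //.
    by case: ifP => _; rewrite ger0_norm // invf_le1 // ler1n.
  rewrite !(normrM (w n)) -mulrDr mulrCA; apply: ler_pM (normr_ge0 _) _ w0 (KP n).
  by rewrite mulr_ge0 ?exprn_ge0 ?addr_ge0.
have cW i : continuous (W i) by move=> t; exact: is_derive_continuous (dW i t).
rewrite (_ : (fun n => _) = (fun n => w n * (fourier_cos (W 0%N) n * cos (n%:R * x) +
    fourier_sin (W 0%N) n * sin (n%:R * x)))); last first.
  by apply/funext => n; move: (w n) => c; ring.
exact: (fourier_cvg (dW 0%N) (dW 1%N) (cW 2%N) (pW 0%N) (pW 1%N)).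
Qed.

End Fourier.

(** * Harmonic power series on the unit disk *)

Section DirectionalDerivative.
Context {R : realType} {V W : normedModType R}.
Implicit Types (f : V -> W) (x v : V).

(** The filter is arbitrary so that the lemma covers directional derivatives, where [h] approaches 0
    from both sides, and the normal derivative, where it does so from the left. *)
Lemma cvg_linear_error (F : set_system R) (q : R -> W) (l : W) K : ProperFilter F ->
  id @ F --> (0 : R) -> (\forall h \near F, `|q h - l| <= K * `|h|) -> q @ F --> l.
Proof.
move=> FF F0 Fq; apply/cvgrPdist_le => e e0; near=> h.
rewrite distrC; apply: (@le_trans _ _ (K * `|h|)); first by near: h.
apply: (@le_trans _ _ ((`|K| + 1) * `|h|)).
  by rewrite ler_wpM2r // (le_trans (ler_norm _)) // lerDl.
rewrite -ler_pdivlMl ?ltr_wpDl //; near: h.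
have := F0; move/cvgrPdist_le => /(_ ((`|K| + 1)^-1 * e)).
rewrite mulr_gt0 // ?invr_gt0 ?ltr_wpDl // => /(_ isT); apply: filterS => h.
by rewrite sub0r normrN.
Unshelve. all: by end_near. Qed.

(** This is how series are differentiated: remainder estimates of the terms add up to one of this
    form, which gives existence and value of the derivative together. *)
Lemma is_derive_quadratic_error f x v (l : W) K :
  (\forall h \near (0 : R), `|f (x + h *: v) - f x - h *: l| <= K * `|h| ^+ 2) ->
  is_derive x v f l.
Proof.
move=> fl.
suff H : (fun h : R => h^-1 *: ((f \o shift x) (h *: v) - f x)) @ 0^' --> l.
  by apply: DeriveDef; [apply/cvg_ex; exists l|apply/cvg_lim].
apply: (@cvg_linear_error _ _ _ K); first exact: nbhs_dnbhs.
near=> h; have h0 : h != 0 by near: h; exact: nbhs_dnbhs_neq.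
have -> : h^-1 *: ((f \o shift x) (h *: v) - f x) - l =
    h^-1 *: (f (x + h *: v) - f x - h *: l).
  by rewrite /= [h *: v + x]addrC [RHS]scalerBr scalerA mulVf // scale1r.
rewrite normrZ normfV ler_pdivrMl ?normr_gt0 // mulrCA -expr2.
by near: h; exact: nbhs_dnbhs.
Unshelve. all: by end_near. Qed.

Lemma is_derive_affine_line f x v (l : W) :
  (forall h : R, f (x + h *: v) = f x + h *: l) -> is_derive x v f l.
Proof.
move=> fl; apply: (@is_derive_quadratic_error _ _ _ _ 0); near=> h.
by rewrite fl addrAC addrK subrr normr0 mul0r.
Unshelve. all: by end_near. Qed.

Lemma is_derive_line f x v (l : W) (t : R) : is_derive (x + t *: v) v f l ->
  is_derive t (1 : R) (fun s => f (x + s *: v)) l.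
Proof.
have E : (fun h : R => h^-1 *: (((fun s => f (x + s *: v)) \o shift t) (h *: (1 : R))
    - f (x + t *: v))) =
  (fun h => h^-1 *: ((f \o shift (x + t *: v)) (h *: v) - f (x + t *: v))).
  apply/funext => h /=; rewrite [h%:A]mulr1 scalerDl addrCA.
  by rewrite [x + _]addrC.
move=> [d e]; apply: DeriveDef; first by rewrite /derivable E.
by rewrite /derive E.
Qed.

End DirectionalDerivative.

Local Notation xc z := (z 0 (@ord0 1)).
Local Notation yc z := (z 0 (@ord_max 1)).

(** * Powers of a complex variable, with Taylor estimates *)

Section ComplexPowers.
Context {R : realType}.
Implicit Types (x z w d v : 'rV[R]_2) (n : nat) (h t : R).

Lemma ord2_cases (j : 'I_2) : j = ord0 \/ j = ord_max.
Proof.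
by case: j => [[|[|//]]] lj; [left|right]; exact: val_inj.
Qed.

Lemma row2P z w : xc z = xc w -> yc z = yc w -> z = w.
Proof.
move=> ex ey; apply/rowP => j.
by have [->|->] := ord2_cases j.
Qed.

Lemma is_derive_coord j z v : is_derive z v (fun w => w 0 j) (v 0 j).
Proof. by apply: is_derive_affine_line => h; rewrite !mxE. Qed.

Definition sqnorm z : R := xc z ^+ 2 + yc z ^+ 2.

Lemma sqnorm_ge0 z : 0 <= sqnorm z.
Proof. by rewrite addr_ge0 ?sqr_ge0. Qed.

(* Real and imaginary parts of z ^ n, for z = x + i y. *)
Fixpoint cpow n z : R * R := if n is m.+1 then
    (xc z * (cpow m z).1 - yc z * (cpow m z).2,
     xc z * (cpow m z).2 + yc z * (cpow m z).1)
  else (1, 0).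

Lemma sqnorm_cpow n z : (cpow n z).1 ^+ 2 + (cpow n z).2 ^+ 2 = sqnorm z ^+ n.
Proof.
elim: n => [|n IH] /=; first by rewrite expr1n expr0n addr0.
by rewrite [RHS]exprS -IH /sqnorm; ring.
Qed.

Lemma cpow_bound n z : sqnorm z <= 1 -> `|(cpow n z).1| <= 1 /\ `|(cpow n z).2| <= 1.
Proof.
move=> z1; have zn : sqnorm z ^+ n <= 1 by rewrite exprn_ile1 // sqnorm_ge0.
have S (y : R) : y ^+ 2 <= 1 -> `|y| <= 1.
  by rewrite -[`|y| <= 1](@expr_le1 _ 2) // -normrX ger0_norm ?sqr_ge0.
by split; apply: S; apply: le_trans zn; rewrite -sqnorm_cpow ?lerDl ?lerDr sqr_ge0.
Qed.

Lemma is_derive_cpow n z v :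
  is_derive z v (fun w => (cpow n w).1)
    (n%:R * ((cpow n.-1 z).1 * xc v - (cpow n.-1 z).2 * yc v)) /\
  is_derive z v (fun w => (cpow n w).2)
    (n%:R * ((cpow n.-1 z).2 * xc v + (cpow n.-1 z).1 * yc v)).
Proof.
elim: n => [|n [IH1 IH2]] /=.
  by rewrite !mul0r; split; exact: is_derive_constf.
have Dx := is_derive_coord ord0 z v; have Dy := is_derive_coord ord_max z v.
(* The factor [n] makes [z^n = z z^(n-1)] usable at [n = 0] too, where the truncated predecessor
   would falsify it. *)
have E : n%:R * (cpow n z).1 = n%:R * (xc z * (cpow n.-1 z).1 - yc z * (cpow n.-1 z).2)
  /\ n%:R * (cpow n z).2 = n%:R * (xc z * (cpow n.-1 z).2 + yc z * (cpow n.-1 z).1).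
  by case: (n) => [|m] //=; rewrite !mul0r.
rewrite -natr1 !mulrDl !mul1r !mulrDr !mulrN !mulrA !E.1 !E.2; split.
  have := is_derive_subf (is_derive_mulf Dx IH1) (is_derive_mulf Dy IH2).
  by congr (is_derive _ _ _ _); ring.
have := is_derive_addf (is_derive_mulf Dx IH2) (is_derive_mulf Dy IH1).
by congr (is_derive _ _ _ _); ring.
Qed.

(* The triple (a, b, e) encodes the harmonic polynomial a Re z^e + b Im z^e. *)
Definition hterm (p : R * R * nat) z : R :=
  p.1.1 * (cpow p.2 z).1 + p.1.2 * (cpow p.2 z).2.

(* Partial derivatives of harmonic polynomials of this shape have the same shape.
   At e = 0 the truncated exponent is harmless, the coefficients being 0. *)
Definition hterm_d (i : 'I_2) (p : R * R * nat) : R * R * nat :=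
  (if i == ord0 then (p.2%:R * p.1.1, p.2%:R * p.1.2)
   else (p.2%:R * p.1.2, - (p.2%:R * p.1.1)), p.2.-1).

Definition hterm_size (p : R * R * nat) : R := `|p.1.1| + `|p.1.2|.

Lemma hterm_size_d i p : hterm_size (hterm_d i p) = p.2%:R * hterm_size p.
Proof.
rewrite /hterm_size /hterm_d /=; case: ifP => _ /=;
  rewrite ?normrN !normrM ger0_norm ?ler0n //; ring.
Qed.

Lemma hterm_bound p z : sqnorm z <= 1 -> `|hterm p z| <= hterm_size p.
Proof.
move=> z1; have [b1 b2] := cpow_bound p.2 z1.
by rewrite (le_trans (ler_normD _ _)) // !normrM lerD // -[leRHS]mulr1 ler_wpM2l.
Qed.

Definition hterm_grad p z v : R :=
  hterm (hterm_d ord0 p) z * xc v + hterm (hterm_d ord_max p) z * yc v.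

Lemma is_derive_hterm p z v : is_derive z v (hterm p) (hterm_grad p z v).
Proof.
have [D1 D2] := is_derive_cpow p.2 z v.
have := is_derive_addf (is_derive_scalef p.1.1 D1) (is_derive_scalef p.1.2 D2).
by congr (is_derive _ _ _ _); rewrite /hterm_grad /hterm /hterm_d /=; ring.
Qed.

Definition l1 v : R := `|xc v| + `|yc v|.

Lemma l1_ge0 v : 0 <= l1 v. Proof. by rewrite addr_ge0. Qed.

Lemma hterm_grad_bound p z v : sqnorm z <= 1 ->
  `|hterm_grad p z v| <= p.2%:R * hterm_size p * l1 v.
Proof.
move=> z1; rewrite (le_trans (ler_normD _ _)) // !normrM mulrDr.
by rewrite lerD // ler_wpM2r //; apply: le_trans (hterm_bound _ z1) _;
  rewrite hterm_size_d.
Qed.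

(** Convexity of the disk: with [t = l h], the convex combination of the end values exceeds the
    value at [t] by [l (1 - l) h^2 |v|^2]. *)
Lemma sqnorm_segment z v h t r : sqnorm z <= r -> sqnorm (z + h *: v) <= r ->
  Num.min 0 h <= t <= Num.max 0 h -> sqnorm (z + t *: v) <= r.
Proof.
move=> zr zhr th.
have [->|h0] := eqVneq t 0; first by rewrite scale0r addr0.
have [l l01 tl] : exists2 l, 0 <= l <= 1 & t = l * h.
  have [hz|hnz] := eqVneq h 0.
    by move: th; rewrite hz minxx maxxx => /le_anti e; rewrite -e eqxx in h0.
  exists (t / h); last by rewrite divfK.
  move: th; case: (ltgtP 0 h) hnz => // hs _ /andP[t1 t2].
    by rewrite ler_pdivlMr // mul0r t1 ler_pdivrMr // mul1r.
  by rewrite ler_ndivlMr // mul0r t2 ler_ndivrMr // mul1r.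
move: zr zhr; rewrite /sqnorm !mxE tl => zr zhr.
apply: (@le_trans _ _ ((1 - l) * r + l * r)); last by rewrite -mulrDl subrK mul1r.
case/andP: l01 => l0 l1; have l1' : 0 <= 1 - l by rewrite subr_ge0.
apply: le_trans (lerD (ler_wpM2l l1' zr) (ler_wpM2l l0 zhr)).
rewrite -subr_ge0 [leRHS](_ : _ = l * (1 - l) * h ^+ 2 * (xc v ^+ 2 + yc v ^+ 2)).
  by rewrite mulr_ge0 ?sqnorm_ge0 // mulr_ge0 ?sqr_ge0 // mulr_ge0.
ring.
Qed.

Lemma hterm_lipschitz p z v h : sqnorm z <= 1 -> sqnorm (z + h *: v) <= 1 ->
  `|hterm p (z + h *: v) - hterm p z| <= p.2%:R * hterm_size p * l1 v * `|h|.
Proof.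
move=> z1 zh1; rewrite -[X in _ - hterm p X]addr0 -(scale0r v) -{2}[h]subr0.
apply: (@mean_value_bound _ (fun t => hterm p (z + t *: v))
  (fun t => hterm_grad p (z + t *: v) v)) => t.
  by move=> _; apply: is_derive_line; exact: is_derive_hterm.
move=> /andP[t1 t2]; apply: hterm_grad_bound.
by apply: (sqnorm_segment z1 zh1); rewrite !ltW.
Qed.

(** The remainder, as a function of [t], has as derivative the increment of the gradient; the
    Lipschitz bound for the first partial derivatives makes it of order [e^2 |h|], [e] being the
    exponent. The powers of [e] are what rapid decay has to absorb. *)
Lemma hterm_taylor p z v h : sqnorm z <= 1 -> sqnorm (z + h *: v) <= 1 ->
  `|hterm p (z + h *: v) - hterm p z - h * hterm_grad p z v| <=
  p.2%:R ^+ 2 * hterm_size p * (l1 v ^+ 2 * `|h| ^+ 2).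
Proof.
move=> z1 zh1.
pose f t := hterm p (z + t *: v) - t * hterm_grad p z v.
rewrite (_ : _ - _ - _ = f h - f 0); last first.
  by rewrite /f scale0r addr0 mul0r subr0; ring.
rewrite (_ : _ * _ * _ = p.2%:R ^+ 2 * hterm_size p * l1 v ^+ 2 * `|h| * `|h - 0|);
  last by rewrite subr0; ring.
apply: (@mean_value_bound _ f
  (fun t => hterm_grad p (z + t *: v) v - hterm_grad p z v)) => t.
  move=> _; apply: is_derive_subf.
    by apply: is_derive_line; exact: is_derive_hterm.
  have := is_derive_mulf (is_derive_idf t) (is_derive_constf (hterm_grad p z v) t 1).
  by congr (is_derive _ _ _ _); ring.
move=> /andP[t1 t2].
have th : `|t| <= `|h|.
  move: t1 t2; case: (leP 0 h) => hs t1 t2.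
    by rewrite !ger0_norm ?(ltW t1) // ltW.
  by rewrite !ltr0_norm // lerN2 ltW.
have zt1 : sqnorm (z + t *: v) <= 1 by apply: (sqnorm_segment z1 zh1); rewrite !ltW.
have B i : `|hterm (hterm_d i p) (z + t *: v) - hterm (hterm_d i p) z| <=
    p.2%:R ^+ 2 * hterm_size p * l1 v * `|h|.
  apply: le_trans (hterm_lipschitz _ z1 zt1) _.
  rewrite ler_pM ?mulr_ge0 ?l1_ge0 ?addr_ge0 // ler_wpM2r ?l1_ge0 //.
  rewrite hterm_size_d expr2 -mulrA ler_wpM2r ?mulr_ge0 ?addr_ge0 //.
  by rewrite ler_nat /= leq_pred.
rewrite /hterm_grad opprD addrACA -!mulrBl (le_trans (ler_normD _ _)) // !normrM.
apply: le_trans (lerD (ler_wpM2r (normr_ge0 _) (B _)) (ler_wpM2r (normr_ge0 _) (B _))) _.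
by rewrite -mulrDr -/(l1 v) le_eqVlt; apply/orP; left; apply/eqP; ring.
Qed.

End ComplexPowers.

Section SeriesBounds.
Context {R : realType}.
Implicit Types (u w : nat -> R).

Lemma series_dominated u w : (forall n, `|u n| <= w n) -> cvgn (series w) ->
  cvgn (series u) /\ `|limn (series u)| <= limn (series w).
Proof.
move=> uw cw.
have cn : cvgn [normed series u].
  apply: (@series_le_cvg _ _ w) => [n|n|n|//]; last exact: uw.
    exact: normr_ge0.
  exact: le_trans (normr_ge0 _) (uw n).
split; first exact: normed_cvg.
by rewrite (le_trans (lim_series_norm cn)) // lim_series_le.
Qed.

(** Comparison with [1 / (n + 1)^2]: since [(n + 1)^2 <= 2 + 2 n^2], bounds [K] and [L] of orders
    [j] and [j + 2] give the constant [2 K + 2 L], up to [k^j]. The dilation [d n = k n] provides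
    for the exponents on the cone. *)
Lemma cvg_series_rapid u (d : nat -> nat) k : (0 < k)%N ->
  (forall n, d n = k * n)%N ->
  (forall j, exists K, forall n, n%:R ^+ j * u n <= K) -> (forall n, 0 <= u n) ->
  forall j, cvgn (series (fun n => (d n)%:R ^+ j * u n)).
Proof.
move=> k0 dk uK u0 j.
have [K KP] := uK j; have [L LP] := uK j.+2.
have c1 : cvgn (series (fun n => n.+1%:R ^- 2 : R)).
  apply: nondecreasing_is_cvgn.
    by apply: nondecreasing_series => n _ _; rewrite invr_ge0 exprn_ge0.
  exists 2 => _ [n _ <-].
  (* The bound [2 - 1 / (m + 1)] is strong enough for the induction; each step is a telescoping
     comparison. *)
  suff H m : series (fun n => n.+1%:R ^- 2 : R) m.+1 <= 2 - m.+1%:R^-1.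
    case: n => [|n]; first by rewrite /series /= big_geq.
    by rewrite (le_trans (H n)) // gerBl invr_ge0.
  elim: m => [|m IH]; first by rewrite /series /= big_nat1 expr1n invr1; lra.
  rewrite seriesSr; apply: le_trans (lerD IH (lexx _)) _.
  have m1 : 0 < m.+1%:R :> R by rewrite ltr0n.
  have m2 : 0 < m.+2%:R :> R by rewrite ltr0n.
  rewrite -addrA lerD2l -lerBrDl opprK addrC.
  rewrite (_ : _ - _ = (m.+1%:R * m.+2%:R)^-1).
    by rewrite lef_pV2 ?posrE ?exprn_gt0 ?mulr_gt0 // expr2 ler_wpM2r // ?ler_nat // ltW.
  rewrite -[m.+2%:R]natr1 in m2 *; move: (m.+1%:R) m1 m2 => a a0 a1.
  by field; rewrite !gt_eqF.
have c2 := is_cvg_seriesZ (k := k%:R ^+ j * (2 * K + 2 * L)) c1.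
apply: series_le_cvg c2 => n.
- by rewrite mulr_ge0 ?exprn_ge0.
- rewrite mulr_ge0 ?invr_ge0 ?exprn_ge0 // mulr_ge0 ?exprn_ge0 //.
  by rewrite addr_ge0 // mulr_ge0 //; [apply: le_trans (KP 0%N)|apply: le_trans (LP 0%N)];
    rewrite mulr_ge0 ?exprn_ge0.
rewrite dk natrM exprMn -[leRHS]mulrA -mulrA ler_wpM2l ?exprn_ge0 //.
rewrite ler_pdivlMr ?exprn_gt0 //.
have -> : 2 * K + 2 * L = 2 * (K + L) by ring.
apply: (@le_trans _ _ (2 * (n%:R ^+ j * u n + n%:R ^+ j.+2 * u n))); last first.
  by rewrite ler_wpM2l // lerD.
have -> : 2 * (n%:R ^+ j * u n + n%:R ^+ j.+2 * u n) =
    n%:R ^+ j * u n * (2 + 2 * n%:R ^+ 2) by rewrite !exprSr; ring.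
rewrite ler_wpM2l ?mulr_ge0 ?exprn_ge0 // -natr1.
have := sqr_ge0 (n%:R - 1 : R); nra.
Qed.

End SeriesBounds.

(** * Sums of harmonic terms and their derivatives *)

Section HarmonicSeries.
Context {R : realType}.
Implicit Types (c : nat -> R * R * nat) (x z w v : 'rV[R]_2) (r : R).

(** The weights are powers of the exponents, not of the indices: differentiating a term multiplies
    its size by its exponent, so the condition is stable under [hterm_d]. *)
Definition rapid c := forall j,
  cvgn (series (fun n => (c n).2%:R ^+ j * hterm_size (c n))).

(* Only meaningful on the closed unit disk, where the series converges. *)
Definition hsum c z : R := limn (series (fun n => hterm (c n) z)).

Lemma hsum_cvg c z : rapid c -> sqnorm z <= 1 ->
  cvgn (series (fun n => hterm (c n) z)).
Proof.
move=> rc z1.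
apply: (proj1 (series_dominated (fun n => hterm_bound (c n) z1) _)).
rewrite (_ : (fun n => _) = (fun n => (c n).2%:R ^+ 0 * hterm_size (c n))).
  exact: rc.
by apply/funext => n; rewrite expr0 mul1r.
Qed.

Lemma rapid_d i c : rapid c -> rapid (fun n => hterm_d i (c n)).
Proof.
move=> rc j; apply: series_le_cvg (rc j.+1) => n.
- by rewrite mulr_ge0 ?exprn_ge0 // addr_ge0.
- by rewrite mulr_ge0 ?exprn_ge0 // addr_ge0.
rewrite hterm_size_d mulrA exprSr ler_wpM2r ?addr_ge0 // ler_wpM2r //.
by rewrite lerXn2r ?nnegrE // ler_nat /= leq_pred.
Qed.

Definition hsum_grad c z v : R :=
  hsum (fun n => hterm_d ord0 (c n)) z * xc v +
  hsum (fun n => hterm_d ord_max (c n)) z * yc v.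

Lemma hsum_grad_cvg c z v : rapid c -> sqnorm z <= 1 ->
  series (fun n => hterm_grad (c n) z v) @ \oo --> hsum_grad c z v.
Proof.
move=> rc z1.
have -> : (fun n => hterm_grad (c n) z v) =
  xc v \*: (fun n => hterm (hterm_d ord0 (c n)) z) +
  yc v \*: (fun n => hterm (hterm_d ord_max (c n)) z).
  by apply/funext => n; rewrite /hterm_grad ![_ * xc v]mulrC ![_ * yc v]mulrC.
rewrite seriesD !seriesZ /hsum_grad ![_ * xc v]mulrC ![_ * yc v]mulrC.
by apply: cvgD; apply: cvgZr; apply: hsum_cvg => //; exact: rapid_d.
Qed.

(** The termwise estimates are summed, the constant being the sum of order 2 in [rapid]. Points of
    the boundary circle are included, as the normal derivative requires. *)
Lemma hsum_taylor c : rapid c -> exists K, forall z v h, sqnorm z <= 1 ->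
  sqnorm (z + h *: v) <= 1 ->
  `|hsum c (z + h *: v) - hsum c z - h * hsum_grad c z v| <=
  K * (l1 v ^+ 2 * `|h| ^+ 2).
Proof.
move=> rc; exists (limn (series (fun n => (c n).2%:R ^+ 2 * hterm_size (c n)))).
move=> z v h z1 zh1; set k := _ * `|h| ^+ 2.
pose u n := hterm (c n) (z + h *: v) - hterm (c n) z - h * hterm_grad (c n) z v.
have uE : limn (series u) = hsum c (z + h *: v) - hsum c z - h * hsum_grad c z v.
  apply/cvg_lim => //.
  pose A n := hterm (c n) (z + h *: v); pose B n := hterm (c n) z.
  pose C n := hterm_grad (c n) z v.
  rewrite -[u]/(A - B - h \*: C) (seriesD (A - B)) (seriesD A) !seriesN seriesZ.
  apply: cvgB; first by apply: cvgB; exact: hsum_cvg.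
  by apply: cvgZr; exact: hsum_grad_cvg.
have cs := rc 2%N.
have H n : `|u n| <= (k \*: (fun n => (c n).2%:R ^+ 2 * hterm_size (c n))) n.
  by rewrite /= [_ *: _]mulrC; exact: hterm_taylor.
have [_ ] := series_dominated H (is_cvg_seriesZ cs).
by rewrite uE (lim_seriesZ k cs) [k *: _]mulrC; apply.
Qed.

Lemma hsum_lipschitz c : rapid c -> exists K, forall z w, sqnorm z <= 1 ->
  sqnorm w <= 1 -> `|hsum c w - hsum c z| <= K * l1 (w - z).
Proof.
move=> rc; exists (limn (series (fun n => (c n).2%:R * hterm_size (c n)))).
move=> z w z1 w1.
have cs : cvgn (series (fun n => (c n).2%:R * hterm_size (c n))) := rc 1%N.
pose u n := hterm (c n) w - hterm (c n) z.
have uE : limn (series u) = hsum c w - hsum c z.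
  apply/cvg_lim => //.
  pose A n := hterm (c n) w; pose B n := hterm (c n) z.
  rewrite -[u]/(A - B) (seriesD A) seriesN.
  by apply: cvgB; exact: hsum_cvg.
have H n : `|u n| <= (l1 (w - z) \*: (fun n => (c n).2%:R * hterm_size (c n))) n.
  have := @hterm_lipschitz _ (c n) z (w - z) 1.
  rewrite scale1r addrC subrK normr1 mulr1 => /(_ z1 w1).
  by rewrite /= [_ *: _]mulrC.
have [_ ] := series_dominated H (is_cvg_seriesZ cs).
by rewrite uE (lim_seriesZ _ cs) [l1 _ *: _]mulrC; apply.
Qed.

Lemma lipschitz_within_continuous (D : set 'rV[R]_2) (f : 'rV[R]_2 -> R) K :
  (forall z w, D z -> D w -> `|f w - f z| <= K * l1 (w - z)) ->
  {within D, continuous f}.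
Proof.
move=> fK; apply/subspace_continuousP => z Dz; apply/cvgrPdist_le => e e0.
have K1 : 0 < `|K| + 1 by rewrite ltr_wpDl.
have cj j : \forall w \near within D (nbhs z), `|(w - z) 0 j| <= e / 2 / (`|K| + 1).
  apply: cvg_within; have := @coord_continuous R 1 2 0 j z.
  move/cvgrPdist_le => /(_ (e / 2 / (`|K| + 1))).
  rewrite !divr_gt0 // => /(_ isT); apply: filterS => y.
  by rewrite !mxE distrC.
near=> w; rewrite distrC; apply: le_trans (fK _ _ Dz _) _.
  by near: w; exact: withinT.
apply: (@le_trans _ _ ((`|K| + 1) * l1 (w - z))).
  by rewrite ler_wpM2r ?l1_ge0 // (le_trans (ler_norm _)) // lerDl.
rewrite -ler_pdivlMl // /l1 (_ : _ * e = e / 2 / (`|K| + 1) + e / 2 / (`|K| + 1)).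
  by apply: lerD; near: w; exact: cj.
by field; rewrite gt_eqF.
Unshelve. all: by end_near. Qed.

End HarmonicSeries.

(** * Harmonic functions on a round disk *)

Section MaximumPrinciple.
Context {R : realType}.
Implicit Types (x z w v p : 'rV[R]_2) (r t : R).

(** [f1] vanishes at the maximum. If [f2] were positive, [f1] would be positive just to the right of
    0, and the mean value theorem would give a larger value of [f]. *)
Lemma max_second_derivative (f f1 : R -> R) (f2 : R) :
  (\forall t \near (0 : R), is_derive t (1 : R) f (f1 t) /\ f t <= f 0) ->
  is_derive (0 : R) (1 : R) f1 f2 -> f2 <= 0.
Proof.
move=> nf df1; rewrite leNgt; apply/negP => f20.
have [d /= d0 dP] := nf.
have {}dP t : `|t| < d -> is_derive t (1 : R) f (f1 t) /\ f t <= f 0.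
  by move=> td; apply: dP; rewrite /= sub0r normrN.
have f10 : f1 0 = 0.
  have D0 : is_derive (0 : R) (1 : R) f 0.
    apply: (@derive1_at_max _ f (- d) d); first by rewrite (ge0_cp (ltW d0)).
    - by move=> t; rewrite in_itv /= -ltr_norml => /dP[[]].
    - by rewrite in_itv /= oppr_lt0 d0.
    - by move=> t; rewrite in_itv /= -ltr_norml => /dP[].
  have [|[_ <-] _] := dP 0; first by rewrite normr0.
  by case: D0.
have : \forall t \near (0 : R)^'+, 0 < f1 t.
  have [/cvg_ex[l fl] e] := df1.
  have le : l = f2 by rewrite -e; apply/esym/cvg_lim.
  have : (fun h : R => h^-1 *: ((f1 \o shift 0) (h *: 1) - f1 0)) @ 0^'+ --> f2.
    by rewrite -le; exact: cvg_dnbhs_at_right fl.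
  move/cvgr_gt => /(_ _ f20); apply: filter_app; near=> t.
  rewrite /= f10 subr0 addr0 [t%:A]mulr1 /GRing.scale /= pmulr_rgt0 // invr_gt0.
  by near: t; exact: nbhs_right_gt.
move=> [e /= e0 eP].
pose t := Num.min d e / 2.
have t0 : 0 < t by rewrite divr_gt0 // lt_min d0.
have td : t < d by rewrite ltr_pdivrMr // gt_min ltr_pMr // ltr1n.
have te : t < e by rewrite ltr_pdivrMr // gt_min !ltr_pMr // ltr1n ?orbT.
have [s st fs] : exists2 s, s \in `]0, t[ & f t - f 0 = f1 s * (t - 0).
  apply: MVT => // [s|].
    rewrite in_itv /= => /andP[s0 st].
    by apply: (dP s _).1; rewrite gtr0_norm // (lt_trans st).
  apply: derivable_within_continuous => s; rewrite in_itv /= => /andP[s0 st].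
  by have [|[]] := dP s; first by rewrite ger0_norm // (le_lt_trans st).
have [|_] := dP t; first by rewrite gtr0_norm.
rewrite -subr_le0 fs subr0 pmulr_lle0 //; apply/negP; rewrite -ltNge.
move: st; rewrite in_itv /= => /andP[s0 st]; apply: eP => //=.
by rewrite sub0r normrN gtr0_norm // (lt_trans st).
Unshelve. all: by end_near. Qed.

Lemma continuous_sqnorm : continuous (@sqnorm R).
Proof.
have c j : continuous (fun z : 'rV[R]_2 => z 0 j) by exact: coord_continuous.
move=> z; have cc j : {for z, continuous (fun z : 'rV[R]_2 => z 0 j ^+ 2)}.
  exact: (continuousM (c j z) (c j z)).
exact: (continuousD (cc ord0) (cc ord_max)).
Qed.

Lemma open_sqnorm_lt r : open [set z : 'rV[R]_2 | sqnorm z < r].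
Proof.
rewrite (_ : mkset _ = @sqnorm R @^-1` [set t | t < r]) //.
by apply: open_comp; [move=> z _; exact: continuous_sqnorm|exact: open_lt].
Qed.

Lemma near_segment (A : set 'rV[R]_2) x v : open A -> A x ->
  \forall t \near (0 : R), A (x + t *: v).
Proof.
move=> oA Ax; have : (fun t : R => x + t *: v) @ 0 --> x + 0 *: v.
  by apply: cvgD; [exact: cvg_cst|apply: cvgZr_tmp; exact: cvg_id].
by apply; rewrite scale0r addr0; exact: open_nbhs_nbhs.
Qed.

Lemma is_derive_sqnorm z v :
  is_derive z v (@sqnorm R) (2 * (xc z * xc v + yc z * yc v)).
Proof.
have Dx := is_derive_coord ord0 z v; have Dy := is_derive_coord ord_max z v.
have := is_derive_addf (is_derive_mulf Dx Dx) (is_derive_mulf Dy Dy).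
by congr (is_derive _ _ _ _); ring.
Qed.

Lemma compact_disk r : compact [set z : 'rV[R]_2 | sqnorm z <= r].
Proof.
apply: bounded_closed_compact.
  exists (`|r| + 1); split; first exact: num_real.
  move=> M rM z zr /=; apply: le_trans (ltW rM).
  have b j : `|z 0 j| <= `|r| + 1.
    have h (y : R) : y ^+ 2 <= r -> `|y| <= `|r| + 1.
      move=> yr; have := sqr_ge0 (`|y| - 1); have := ler_norm r.
      have := normr_ge0 y; rewrite -(real_normK (num_real y)) in yr; nra.
    move: zr; rewrite /= /sqnorm => zr; apply: h; apply: le_trans zr.
    have [->|->] := ord2_cases j; first by rewrite lerDl sqr_ge0.
    by rewrite lerDr sqr_ge0.
  rewrite -[`|z|]/(mx_norm z) mx_normrE; apply: bigmax_le => [|[i j] _ /=].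
    by rewrite addr_ge0.
  by rewrite ord1.
rewrite (_ : mkset _ = @sqnorm R @^-1` [set t | t <= r]) //.
by apply: closed_comp; [move=> z _; exact: continuous_sqnorm|exact: closed_le].
Qed.

(* Maximum principle: perturb f by a small multiple of |x|^2 - r. *)
Lemma subharmonic_le0 (f : 'rV[R]_2 -> R) (f1 f2 : 'I_2 -> 'rV[R]_2 -> R) r :
  0 < r ->
  {within [set z | sqnorm z <= r], continuous f} ->
  (forall x i, sqnorm x < r -> is_derive x (basis_vec i) f (f1 i x)) ->
  (forall x i, sqnorm x < r -> is_derive x (basis_vec i) (f1 i) (f2 i x)) ->
  (forall x, sqnorm x < r -> 0 <= f2 ord0 x + f2 ord_max x) ->
  (forall x, sqnorm x = r -> f x <= 0) ->
  forall x, sqnorm x <= r -> f x <= 0.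
Proof.
move=> r0 cf df1 df2 lapf bdf x xr; rewrite leNgt; apply/negP => fx0.
(* Here [r] is the squared radius; this [e] ensures [g x >= f x - e r = f x / 2 > 0], while [g = f]
   on the boundary. *)
pose e := f x / (2 * r).
have e0 : 0 < e by rewrite divr_gt0 // mulr_gt0.
pose g z := f z + e * (sqnorm z - r).
have cg : {within [set z | sqnorm z <= r], continuous g}.
  apply/subspace_continuousP => z zr; apply: cvgD.
    by move/subspace_continuousP: cf; exact.
  apply: cvgM; first exact: cvg_cst.
  apply: cvgB; last exact: cvg_cst.
  by apply: cvg_within_filter; exact: continuous_sqnorm.
have [p pr gp] := @EVT_max_rV _ _ g _ (ex_intro _ x xr) (@compact_disk r) cg.
move: pr; rewrite inE /= => pr.
have gx : 0 < g x.
  apply: (@lt_le_trans _ _ (f x - e * r)).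
    by rewrite /e subr_gt0 -mulrA invfM mulrA -mulrA mulfVK ?gt_eqF // ltr_pdivrMr //
      ltr_pMr // ltr1n.
  by rewrite /g mulrBr addrA lerD2r lerDl mulr_ge0 ?sqnorm_ge0 // ltW.
have gp0 : 0 < g p by apply: lt_le_trans gx _; apply: gp; rewrite inE.
have {}pr : sqnorm p < r.
  rewrite lt_neqAle pr andbT; apply/eqP => pe.
  by have := bdf p pe; rewrite leNgt; move: gp0; rewrite /g pe subrr mulr0 addr0 => ->.
(* The perturbation adds [2 e] to each pure second derivative, so their sum is positive at the
   maximum [p] and one of them is. *)
have [i fi] : exists i, 0 < f2 i p + 2 * e.
  have [h|h] := ltP 0 (f2 ord0 p + 2 * e); first by exists ord0.
  by exists ord_max; have := lapf p pr; lra.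
pose v : 'rV[R]_2 := basis_vec i.
have vv : xc v * xc v + yc v * yc v = 1.
  rewrite /v /basis_vec !mxE eqxx /=.
  by case: (i) => [[|[|//]]] li /=; rewrite !(mulr1, mulr0, addr0, add0r).
suff : f2 i p + 2 * e <= 0 by rewrite leNgt fi.
apply: (@max_second_derivative (fun t => g (p + t *: v))
  (fun t => f1 i (p + t *: v) + e * (2 * (xc (p + t *: v) * xc v + yc (p + t *: v) * yc v)))).
  have := near_segment v (@open_sqnorm_lt r) pr.
  apply: filterS => t /= ptr; split; last first.
    by rewrite scale0r addr0; apply: gp; rewrite inE /= ltW.
  apply: is_derive_line; apply: is_derive_addf; first exact: df1.
  have := is_derive_scalef e (is_derive_subf (is_derive_sqnorm (p + t *: v) v)
    (is_derive_constf r (p + t *: v) v)).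
  by rewrite subr0.
have D1 : is_derive (p + 0 *: v) v (f1 i) (f2 i p).
  by rewrite scale0r addr0; exact: df2.
have D2 := is_derive_line D1.
apply: is_derive_addf D2 _.
have H (j : 'I_2) : is_derive (0 : R) (1 : R) (fun t => (p + t *: v) 0 j * v 0 j) (v 0 j * v 0 j).
  have := is_derive_line (is_derive_coord j (p + 0 *: v) v).
  move/(is_derive_mulf (g := fun=> v 0 j)) => /(_ 0 (is_derive_constf _ _ _)).
  by rewrite mulr0 addr0.
have := is_derive_scalef e (is_derive_scalef 2 (is_derive_addf (H ord0) (H ord_max))).
by rewrite vv mulr1 [e * 2]mulrC.
Qed.

End MaximumPrinciple.

(** * Laplacian, uniqueness and normal derivative in the disk chart *)

Section DiskChart.
Context {R : realType} (r : R) (G : set ('rV[R]_2 -> 'rV[R]_2)).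
Hypothesis r0 : 0 < r.
Implicit Types (x z v : 'rV[R]_2) (c : nat -> R * R * nat).

Let C := disk_chart r G.

Lemma disk_domE x : ch_dom C x <-> sqnorm x <= r ^+ 2.
Proof. by split=> [[_]|h]; [|split=> //]; rewrite /= /disk_rho subr_le0. Qed.

Lemma disk_intE x : ch_int C x <-> sqnorm x < r ^+ 2.
Proof. by split=> [[_]|h]; [|split=> //]; rewrite /= /disk_rho subr_lt0. Qed.

Lemma disk_bdE x : ch_bd C x <-> sqnorm x = r ^+ 2.
Proof.
split=> [[_]|h]; first by move/eqP; rewrite /= /disk_rho subr_eq0 => /eqP.
by split=> //; apply/eqP; rewrite /= /disk_rho subr_eq0; apply/eqP.
Qed.

Lemma sqnormZ (k : R) x : sqnorm (k *: x) = k ^+ 2 * sqnorm x.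
Proof. by rewrite /sqnorm !mxE; ring. Qed.

Let scaled_le1 x : (sqnorm (r^-1 *: x) <= 1) = (sqnorm x <= r ^+ 2).
Proof. by rewrite sqnormZ exprVn ler_pdivrMl ?exprn_gt0 // mulr1. Qed.

Definition hword (s : seq 'I_2) c : nat -> R * R * nat :=
  foldr (fun i d n => hterm_d i (d n)) c s.

(** The witness for [smooth_upto]; the power of [r^-1] is the chain rule for the scaling to the unit
    disk. *)
Definition hpartial c (s : seq 'I_2) x : R :=
  r^-1 ^+ size s * hsum (hword s c) (r^-1 *: x).

Lemma rapid_hword s c : rapid c -> rapid (hword s c).
Proof. by move=> rc; elim: s => [//|i s IH] /=; exact: rapid_d. Qed.

Lemma is_derive_hsum c x v : rapid c -> ch_int C x ->
  is_derive x v (fun y => hsum c (r^-1 *: y)) (r^-1 * hsum_grad c (r^-1 *: x) v).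
Proof.
move=> rc /disk_intE xr.
have [K KP] := hsum_taylor rc.
apply: (@is_derive_quadratic_error _ _ _ _ _ _ _ (K * l1 (r^-1 *: v) ^+ 2)).
have := near_segment v (@open_sqnorm_lt R (r ^+ 2)) xr.
apply: filterS => h /= xhr.
have := KP (r^-1 *: x) (r^-1 *: v) h.
rewrite scaled_le1 scalerA mulrC -scalerA -scalerDr scaled_le1 => /(_ (ltW xr) (ltW xhr)).
have -> : hsum_grad c (r^-1 *: x) (r^-1 *: v) = r^-1 * hsum_grad c (r^-1 *: x) v.
  by rewrite /hsum_grad !mxE; ring.
by rewrite mulrA.
Qed.

Lemma is_derive_hpartial c s i x : rapid c -> ch_int C x ->
  is_derive x (basis_vec i) (hpartial c s) (hpartial c (i :: s) x).
Proof.
move=> rc xr; have := is_derive_hsum (basis_vec i) (@rapid_hword s _ rc) xr.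
move/(is_derive_scalef (r^-1 ^+ size s)); congr (is_derive _ _ _ _).
rewrite /hpartial /= exprSr -mulrA; congr (_ * (_ * _)).
rewrite /hsum_grad /basis_vec !mxE !eqxx /=.
case: (i) => [[|[|//]]] li /=; rewrite ?mulr1 ?mulr0 ?addr0 ?add0r.
  by congr (hsum (fun n => hterm_d _ _) _); apply: val_inj.
by congr (hsum (fun n => hterm_d _ _) _); apply: val_inj.
Qed.

Lemma continuous_hpartial c s : rapid c -> {within ch_dom C, continuous (hpartial c s)}.
Proof.
move=> rc; have [K KP] := hsum_lipschitz (@rapid_hword s _ rc).
apply: (@lipschitz_within_continuous _ _ _ (`|r^-1 ^+ size s| * (K * r^-1))).
move=> z w /disk_domE zr /disk_domE wr.
rewrite /hpartial -mulrBr normrM -mulrA ler_wpM2l //.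
have := KP (r^-1 *: z) (r^-1 *: w); rewrite !scaled_le1 => /(_ zr wr).
rewrite -scalerBr /l1 !mxE !normrM -mulrDr ger0_norm ?invr_ge0 ?(ltW r0) //.
by rewrite mulrA.
Qed.

Lemma smooth_hsum c f : rapid c ->
  (forall x, ch_dom C x -> f x = hsum c (r^-1 *: x)) ->
  smooth_upto (ch_int C) (ch_dom C) f.
Proof.
move=> rc fc; exists (hpartial c); split=> [x xD|s|s i x xI].
- by rewrite fc // /hpartial expr0 mul1r.
- exact: continuous_hpartial.
- exact: is_derive_hpartial.
Qed.

Lemma hpartial_harmonic c x : rapid c -> ch_dom C x ->
  hpartial c [:: ord0; ord0] x + hpartial c [:: ord_max; ord_max] x = 0.
Proof.
move=> rc /disk_domE xr; rewrite /hpartial /= -mulrDr.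
suff -> : hsum (hword [:: ord0; ord0] c) (r^-1 *: x) =
    - hsum (hword [:: ord_max; ord_max] c) (r^-1 *: x) by rewrite addNr mulr0.
rewrite /hsum -lim_seriesN; last first.
  by apply: hsum_cvg; [exact: rapid_hword|rewrite scaled_le1].
congr (limn (series _)); apply/funext => n.
by rewrite !fctE /hterm /hterm_d /=; ring.
Qed.

Lemma near_interior x : ch_int C x -> \forall y \near x, ch_int C y.
Proof.
move=> /disk_intE xr.
have : \forall y \near x, [set z | sqnorm z < r ^+ 2] y.
  exact: open_nbhs_nbhs (conj (@open_sqnorm_lt R _) xr).
by apply: filterS => y /disk_intE.
Qed.

(** The identity metric collapses the divergence form to the sum of second derivatives. [F] and [f]
    agree only on the disk, so they are compared on neighbourhoods of interior points. *)
Lemma disk_laplacian (F : seq 'I_2 -> 'rV[R]_2 -> R) f x :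
  (forall y, ch_dom C y -> F [::] y = f y) ->
  (forall s i y, ch_int C y -> is_derive y (basis_vec i) (F s) (F (i :: s) y)) ->
  ch_int C x ->
  laplacian C f x = F [:: ord0; ord0] x + F [:: ord_max; ord_max] x.
Proof.
move=> Ff dF xI.
have int_dom y : ch_int C y -> ch_dom C y.
  by move=> /disk_intE/ltW yr; apply/disk_domE.
have df y i : ch_int C y -> 'D_(basis_vec i) f y = F [:: i] y.
  move=> yI; have [_ <-] := dF [::] i y yI.
  apply: near_eq_derive; have := near_interior yI.
  by apply: filterS => z /int_dom zD; rewrite Ff.
have ddf i : 'D_(basis_vec i) ('D_(basis_vec i) f) x = F [:: i; i] x.
  have [_ <-] := dF [:: i] i x xI.
  apply: near_eq_derive; have := near_interior xI.
  by apply: filterS => z zI; rewrite df.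
rewrite /laplacian /= det1 sqrtr1 invr1 mul1r.
rewrite -(ddf ord0) -(ddf ord_max) big_ord_recl big_ord_recl big_ord0 addr0.
have e (i : 'I_2) : (fun y => 1 * \sum_j invmx 1%:M i j * 'D_(basis_vec j) f y) =
    'D_(basis_vec i) f.
  apply/funext => y; rewrite mul1r (bigD1 i) //= invmx1 mxE eqxx mul1r big1 ?addr0 //.
  by move=> j ji; rewrite mxE eq_sym (negPf ji) mul0r.
rewrite !e; congr (_ + 'D_(basis_vec _) ('D_(basis_vec _) f) x); exact: val_inj.
Qed.

(* All derivatives of f up to order 2 are read off the witness of smooth_upto,
   since f itself is only meaningful on the closed disk. *)
Lemma harmonic_unique f g :
  smooth_upto (ch_int C) (ch_dom C) f -> smooth_upto (ch_int C) (ch_dom C) g ->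
  (forall x, ch_int C x -> laplacian C f x = 0) ->
  (forall x, ch_int C x -> laplacian C g x = 0) ->
  (forall x, ch_bd C x -> f x = g x) ->
  forall x, ch_dom C x -> f x = g x.
Proof.
move=> sf sg lf lg fg x xD; apply/eqP; rewrite eq_le.
have r20 : 0 < r ^+ 2 by rewrite exprn_gt0.
have domE : ch_dom C = [set z | sqnorm z <= r ^+ 2].
  by apply/seteqP; split=> z /disk_domE.
wlog suff : f g sf sg lf lg fg / f x <= g x.
  by move=> H; apply/andP; split; apply: H => // y yb; rewrite fg.
move: sf sg => [F [Ff cF dF]] [H [Hg cH dH]].
have bd_dom y : sqnorm y = r ^+ 2 -> ch_dom C y by move=> yr; apply/disk_domE; rewrite yr.
rewrite -subr_le0 -Ff // -Hg //.
apply: (@subharmonic_le0 _ (fun y => F [::] y - H [::] y)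
  (fun i y => F [:: i] y - H [:: i] y)
  (fun i y => F [:: i; i] y - H [:: i; i] y) (r ^+ 2)) => //.
- rewrite -domE; apply/subspace_continuousP => z zD; apply: cvgB.
    by move/subspace_continuousP: (cF [::]); exact.
  by move/subspace_continuousP: (cH [::]); exact.
- by move=> y i /disk_intE yI; apply: is_derive_subf; [exact: dF|exact: dH].
- by move=> y i /disk_intE yI; apply: is_derive_subf; [exact: dF|exact: dH].
- move=> y /disk_intE yI; rewrite addrACA -opprD.
  by rewrite -(disk_laplacian Ff dF yI) -(disk_laplacian Hg dH yI) lf // lg // subrr.
- move=> y yr; rewrite Ff ?Hg ?fg ?subrr //; try exact: bd_dom.
  exact/disk_bdE.
- by move: xD; rewrite domE.
Qed.

Lemma hsum_harmonic c f : rapid c ->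
  (forall x, ch_dom C x -> f x = hsum c (r^-1 *: x)) ->
  forall x, ch_int C x -> laplacian C f x = 0.
Proof.
move=> rc fc x xI.
have xD : ch_dom C x by apply/disk_domE/ltW/disk_intE.
have E y : ch_dom C y -> hpartial c [::] y = f y.
  by move=> yD; rewrite fc // /hpartial expr0 mul1r.
rewrite (disk_laplacian E _ xI) ?hpartial_harmonic //.
by move=> s i y yI; exact: is_derive_hpartial.
Qed.

Lemma disk_gradient x : gradient (disk_rho r) x = 2 *: x.
Proof.
apply/rowP => i; rewrite !mxE.
have := is_derive_subf (is_derive_sqnorm x (basis_vec i))
  (is_derive_constf (r ^+ 2) x (basis_vec i)).
rewrite subr0 => -[_ ->]; rewrite /basis_vec !mxE eqxx /=.
case: i => [[|[|//]]] li /=; rewrite !(mulr1, mulr0, addr0, add0r);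
  by congr (_ * x _ _); apply: val_inj.
Qed.

Lemma inner1 v w : inner 1%:M v w = xc v * xc w + yc v * yc w.
Proof.
rewrite /inner mulmx1 mxE big_ord_recl big_ord_recl big_ord0 addr0 !mxE.
by congr (_ + v 0 _ * w 0 _); apply: val_inj.
Qed.

Lemma disk_outward_normal x : ch_bd C x -> outward_normal C x = r^-1 *: x.
Proof.
move=> /disk_bdE xr; rewrite /outward_normal /= disk_gradient invmx1 mulmx1 inner1.
rewrite !mxE (_ : _ + _ = (2 * r) ^+ 2); last first.
  by rewrite exprMn -xr /sqnorm; ring.
rewrite sqrtr_sqr ger0_norm ?mulr_ge0 ?(ltW r0) // scalerA; congr (_ *: _).
by field; rewrite gt_eqF.
Qed.

Lemma hterm_grad_radial p z : hterm_grad p z z = p.2%:R * hterm p z.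
Proof.
rewrite /hterm_grad /hterm /hterm_d /=.
by case: (p.2) => [|m] /=; ring.
Qed.

(** Coefficients of the Euler field [x d/dx + y d/dy] applied to the series: a homogeneous term is
    multiplied by its degree. *)
Definition euler c : nat -> R * R * nat :=
  fun n => ((c n).2%:R * (c n).1.1, (c n).2%:R * (c n).1.2, (c n).2).

Lemma hsum_euler c z : rapid c -> sqnorm z <= 1 ->
  hsum_grad c z z = hsum (euler c) z.
Proof.
move=> rc z1; apply/esym/cvg_lim => //.
rewrite (_ : (fun n => _) = fun n => hterm_grad (c n) z z); last first.
  by apply/funext => n; rewrite hterm_grad_radial /hterm /=; ring.
exact: hsum_grad_cvg.
Qed.

Lemma hsum_normal_derivative c f x : rapid c ->
  (forall x, ch_dom C x -> f x = hsum c (r^-1 *: x)) -> ch_bd C x ->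
  normal_derivative C f x = r^-1 * hsum (euler c) (r^-1 *: x).
Proof.
move=> rc fc xb; rewrite /normal_derivative disk_outward_normal //.
have /disk_bdE xr := xb.
have z1 : sqnorm (r^-1 *: x) <= 1 by rewrite scaled_le1 xr.
rewrite -hsum_euler //; apply/cvg_lim => //.
have [K KP] := hsum_taylor rc; set z := r^-1 *: x.
apply: (@cvg_linear_error _ _ _ _ _ (K * l1 (r^-1 *: z) ^+ 2)).
  exact: cvg_within.
(* For [- r < t < 0] the point [(1 + t / r) x] stays in the disk, where the series represents [f]
   and the Taylor bound applies. *)
have t2 : \forall t \near (0 : R)^'-, - r < t by apply: nbhs_left_gt; rewrite oppr_lt0.
near=> t.
have tn : t < 0 by near: t; exact: nbhs_left_lt.
have tr : - r < t by near: t.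
have xt : sqnorm (x + t *: z) <= r ^+ 2.
  have -> : x + t *: z = (1 + t / r) *: x by rewrite /z scalerDl scale1r scalerA.
  rewrite sqnormZ xr -[leRHS]mul1r ler_wpM2r ?exprn_ge0 ?(ltW r0) //.
  have : 0 <= 1 + t / r.
    rewrite (_ : 1 + t / r = (r + t) / r); last by field; rewrite gt_eqF.
    by rewrite divr_ge0 ?(ltW r0) // -lerBlDl sub0r ltW.
  have : 1 + t / r <= 1 by rewrite gerDl ler_pdivrMr // mul0r ltW.
  by move=> h1 h2; rewrite exprn_ile1.
rewrite !fc; [|by apply/disk_domE; rewrite xr|exact/disk_domE].
have := KP z (r^-1 *: z) t z1.
have zt : z + t *: (r^-1 *: z) = r^-1 *: (x + t *: z).
  by rewrite scalerDr -/z !scalerA [t * _]mulrC.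
rewrite zt scaled_le1 => /(_ xt).
have -> : hsum_grad c z (r^-1 *: z) = r^-1 * hsum_grad c z z.
  by rewrite /hsum_grad !mxE; ring.
have t0 : t != 0 by rewrite lt_eqF.
rewrite (_ : t^-1 * _ - _ = t^-1 * (hsum c (r^-1 *: (x + t *: z)) - hsum c z -
  t * (r^-1 * hsum_grad c z z))); last by field; rewrite t0 gt_eqF.
rewrite normrM normfV ler_pdivrMl ?normr_gt0 // => h.
by apply: le_trans h _; rewrite le_eqVlt; apply/orP; left; apply/eqP; ring.
Unshelve. all: by end_near. Qed.

End DiskChart.

(** * Polar coordinates and boundary curves *)

Section Polar.
Context {R : realType}.
Implicit Types (x : 'rV[R]_2) (a b t rho : R) (n k : nat).

Definition polar rho t : 'rV[R]_2 :=
  \row_(j < 2) (if j == ord0 then rho * cos t else rho * sin t).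

Lemma polar_x rho t : xc (polar rho t) = rho * cos t. Proof. by rewrite mxE. Qed.
Lemma polar_y rho t : yc (polar rho t) = rho * sin t. Proof. by rewrite mxE. Qed.

Lemma sqnorm_polar rho t : sqnorm (polar rho t) = rho ^+ 2.
Proof. by rewrite /sqnorm polar_x polar_y !exprMn -mulrDr cos2Dsin2 mulr1. Qed.

Lemma polarZ c rho t : c *: polar rho t = polar (c * rho) t.
Proof. by apply: row2P; rewrite mxE ?polar_x ?polar_y mulrA. Qed.

Lemma unit_circle_polar a b : a ^+ 2 + b ^+ 2 = 1 -> exists t, a = cos t /\ b = sin t.
Proof.
move=> ab; have a1 : -1 <= a <= 1.
  rewrite -ler_norml -(@expr_le1 _ 2 `|a|) // -normrX ger0_norm ?sqr_ge0 //.
  by rewrite -ab lerDl sqr_ge0.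
have bs : sin (acos a) = `|b|.
  by rewrite sin_acos // (_ : 1 - a ^+ 2 = b ^+ 2) ?sqrtr_sqr // -ab addrAC subrr add0r.
have [b0|b0] := leP 0 b.
  by exists (acos a); rewrite acosK // bs ger0_norm.
exists (- acos a); rewrite cosN sinN acosK // bs ltr0_norm //.
by rewrite opprK.
Qed.

Lemma polar_surj x rho : 0 <= rho -> sqnorm x = rho ^+ 2 -> exists t, x = polar rho t.
Proof.
rewrite le_eqVlt => /orP[/eqP<-|r0 xr].
  rewrite expr0n /= /sqnorm => /eqP.
  rewrite paddr_eq0 ?sqr_ge0 // !sqrf_eq0 => /andP[/eqP x0 /eqP y0].
  by exists 0; apply: row2P; rewrite ?polar_x ?polar_y mul0r.
have [|t [xt yt]] := @unit_circle_polar (xc x / rho) (yc x / rho).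
  by rewrite !exprMn -mulrDl -/(sqnorm x) xr -exprMn divff ?gt_eqF // expr1n.
exists t; apply: row2P; rewrite ?polar_x ?polar_y -?xt -?yt mulrC divfK //;
  by rewrite gt_eqF.
Qed.

Lemma cpow_polar n rho t :
  cpow n (polar rho t) = (rho ^+ n * cos (n%:R * t), rho ^+ n * sin (n%:R * t)).
Proof.
elim: n => [|n IH] /=; first by rewrite mul0r cos0 sin0 expr0 !mul1r.
rewrite IH polar_x polar_y -natr1 mulrDl mul1r cosD sinD exprS /=.
by congr pair; ring.
Qed.

Lemma rotation_polar a rho t : rotation a (polar rho t) = polar rho (a + t).
Proof.
apply: row2P; rewrite ?polar_x ?polar_y mxE /= polar_x polar_y ?cosD ?sinD; ring.
Qed.

Lemma cos_int2pi t (m : int) : cos (t + m%:~R * (2 * pi)) = cos t :> R.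
Proof.
have P n s : cos (s + n%:R * (2 * pi)) = cos s :> R.
  have := periodicn (@cosD2pi R) n s; congr (cos (_ + _) = _).
  by rewrite -[LHS]mulr_natl -[pi *+ 2]mulr_natl.
case: m => n; first exact: P.
by rewrite NegzE mulrNz mulNr -pmulrn -[LHS](P n.+1) subrK.
Qed.

Lemma sin_int2pi t (m : int) : sin (t + m%:~R * (2 * pi)) = sin t :> R.
Proof.
by rewrite -[LHS]opprK -cosDpihalf addrAC cos_int2pi cosDpihalf opprK.
Qed.

(** Removing full turns leaves a difference [d] in [[0, 2 pi[] with [cos d = 1], hence
    [sin (d / 2) = 0]; the sine is positive on []0, pi[], so [d = 0]. *)
Lemma cos_sin_eq a b : cos a = cos b -> sin a = sin b ->
  exists m : int, a = b + m%:~R * (2 * pi).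
Proof.
move=> ca sa; have pi2 : 0 < 2 * pi :> R by rewrite mulr_gt0 // pi_gt0.
pose m := Num.floor ((a - b) / (2 * pi)); exists m.
have d1 : m%:~R * (2 * pi) <= a - b by rewrite -ler_pdivlMr // floor_le_tmp.
have d2 : a - b < m%:~R * (2 * pi) + 2 * pi.
  by rewrite -[X in _ < _ + X]mul1r -mulrDl -ltr_pdivrMr // -intrD1 floorD1_gt.
pose d := a - b - m%:~R * (2 * pi).
have cd : cos d = 1.
  have -> : d = a - b + (- m)%:~R * (2 * pi) by rewrite /d mulrNz mulNr.
  by rewrite cos_int2pi cosB ca sa -!expr2 cos2Dsin2.
have s0 : sin (d / 2) = 0.
  apply/eqP; rewrite -sqrf_eq0.
  have := cos_mulr2n (d / 2); have := cos2Dsin2 (d / 2).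
  have -> : d / 2 *+ 2 = d by rewrite -[LHS]mulr_natr divfK.
  by rewrite cd => e1 e2; apply/eqP; lra.
have : d / 2 = 0.
  apply/eqP; apply: contraTT isT => d0.
  suff : 0 < sin (d / 2) by rewrite s0 ltxx.
  apply: sin_gt0_pi; apply/andP; split; last by rewrite /d; lra.
  by rewrite lt_neqAle eq_sym d0 /= /d; lra.
rewrite /d; lra.
Qed.

Lemma polar_eq rho a b : 0 < rho ->
  polar rho a = polar rho b <-> exists m : int, a = b + m%:~R * (2 * pi).
Proof.
move=> r0; have rn : rho != 0 by rewrite gt_eqF.
split=> [e|[m ->]].
  apply: cos_sin_eq; apply: (mulfI rn).
    by rewrite -!polar_x e.
  by rewrite -!polar_y e.
by apply: row2P; rewrite ?polar_x ?polar_y ?cos_int2pi ?sin_int2pi.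
Qed.

End Polar.

(** * Unit-speed curves on a circle *)

Section BoundaryCurves.
Context {R : realType}.
Implicit Types (f : R -> R) (s t : R).

Lemma near_derive0_constant f t : (\forall s \near t, is_derive s (1 : R) f 0) ->
  \forall s \near t, f s = f t.
Proof.
move=> [d /= d0 dP]; exists d => // s /= st; apply/eqP; rewrite -subr_eq0 -normr_le0.
apply: (@le_trans _ _ (0 * `|s - t|)); last by rewrite mul0r.
apply: (@mean_value_bound _ f (fun=> 0)) => y; last by rewrite normr0.
move=> yst; apply: dP => /=; apply: le_lt_trans st.
move: yst; case: (leP t s) => ts /andP[y1 y2].
  by rewrite !ler0_norm ?subr_le0 // !opprB lerD2r.
by rewrite !ger0_norm ?subr_ge0 ?(ltW ts) // lerD2l lerN2.
Qed.

Lemma smooth_near_of (W : nat -> R -> R) f t :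
  (forall n s, is_derive s (1 : R) (W n) (W n.+1 s)) ->
  (\forall s \near t, f s = W 0%N s) -> smooth_near f t.
Proof.
move=> dW /nbhs_interior fW; apply: filterS fW => s fWs n.
suff E m : \forall y \near s, derive1n m f y = W m y.
  have [dWn _] := dW n s; apply: near_eq_derivable dWn.
  by have := E n; apply: filterS => y ->.
elim: m => [|m /nbhs_interior IH]; first exact: fWs.
apply: filterS IH => y IH.
rewrite derive1nS derive1E (near_eq_derive _ IH).
by have [_ ->] := dW m y.
Qed.

End BoundaryCurves.

Section ArclengthCircle.
Context {R : realType} (r : R) (G : set ('rV[R]_2 -> 'rV[R]_2)).
Hypothesis r0 : 0 < r.
Implicit Types (c : R -> 'rV[R]_2) (s t th e : R).

Let C := disk_chart r G.
Let rn : r != 0. Proof. by rewrite gt_eqF. Qed.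

(** Each derivative advances the phase by [pi / 2], which gives all of them in closed form; a sine
    is treated as a cosine with phase [- pi / 2]. *)
Lemma is_derive_cos_iter (e b t : R) n :
  is_derive t (1 : R) (fun s : R => e ^+ n * cos (e * s + b + n%:R * (pi / 2)))
    (e ^+ n.+1 * cos (e * t + b + n.+1%:R * (pi / 2))).
Proof.
have := is_derive_scalef (e ^+ n) (is_derive_cos_affine e (b + n%:R * (pi / 2)) t).
under eq_fun do rewrite addrA.
congr (is_derive _ _ _ _).
have -> : e * t + b + n.+1%:R * (pi / 2) = e * t + (b + n%:R * (pi / 2)) + pi / 2.
  by rewrite -[n.+1%:R]natr1; ring.
by rewrite cosDpihalf exprSr; ring.
Qed.

Lemma circle_arclength e th t : e ^+ 2 = 1 ->
  arclength_curve C (fun s => polar r (e * s / r + th)) t.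
Proof.
move=> e1.
have E s : e * s / r + th = (e / r) * s + th by rewrite mulrAC.
have dx s : is_derive s (1 : R) (fun s => polar r (e * s / r + th) 0 ord0)
    (- e * sin (e * s / r + th)).
  have := is_derive_scalef r (is_derive_cos_affine (e / r) th s).
  under eq_fun do rewrite -E -polar_x.
  by rewrite -E; congr (is_derive _ _ _ _); field.
have dy s : is_derive s (1 : R) (fun s => polar r (e * s / r + th) 0 ord_max)
    (e * cos (e * s / r + th)).
  have := is_derive_scalef r (is_derive_sin_affine (e / r) th s).
  under eq_fun do rewrite -E -polar_y.
  by rewrite -E; congr (is_derive _ _ _ _); field.
have dj (P : 'I_2 -> Prop) : P ord0 -> P ord_max -> forall j, P j.
  by move=> P0 P1 j; have [->|->] := ord2_cases j.
split.
  apply: dj; [apply: (@smooth_near_of _ (fun n s => r * ((e / r) ^+ n * cos (e / r * s + th + n%:R * (pi / 2)))))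
    | apply: (@smooth_near_of _ (fun n s => r * ((e / r) ^+ n * cos (e / r * s + (th - pi / 2) + n%:R * (pi / 2)))))].
  - by move=> n s; apply: is_derive_scalef; exact: is_derive_cos_iter.
  - by near=> s; rewrite polar_x E expr0 mul1r mul0r addr0.
  - by move=> n s; apply: is_derive_scalef; exact: is_derive_cos_iter.
  - by near=> s; rewrite polar_y E expr0 mul1r mul0r addr0 addrA cosBpihalf.
near=> s; split; first by apply/disk_bdE; rewrite sqnorm_polar.
have dc : derivable (fun s => polar r (e * s / r + th)) s 1.
  apply/derivable_mxP => i j; rewrite ord1; move: j; apply: dj.
    by case: (dx s).
  by case: (dy s).
rewrite derive_mx // inner1 !mxE.
have [_ ->] := dx s; have [_ ->] := dy s.
by rewrite -!expr2 !exprMn sqrrN -mulrDr addrC cos2Dsin2 mulr1.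
Unshelve. all: by end_near. Qed.

(** Position and velocity are orthogonal of lengths [r] and 1, so [w = x y' - y x'] satisfies
    [w^2 = r^2] and is locally constant by continuity. Then [(x, y)] solves the linear equation of
    uniform rotation with angular speed [e / r], [e = w / r]. *)
Lemma arclength_circle c t : arclength_curve C c t ->
  exists e th, e ^+ 2 = 1 /\ \forall s \near t, c s = polar r (e * s / r + th).
Proof.
move=> [sm cb].
pose x s : R := c s 0 (@ord0 1); pose y s : R := c s 0 (@ord_max 1).
have sx := sm ord0; have sy := sm ord_max.
have xy : \forall s \near t, x s ^+ 2 + y s ^+ 2 = r ^+ 2.
  by apply: filterS cb => s [/disk_bdE].
pose dx := derive1 x; pose dy := derive1 y.
have Dx : \forall s \near t, is_derive s (1 : R) x (dx s) /\
    is_derive s (1 : R) dx (derive1 dx s).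
  apply: filterS sx => s xs; rewrite /dx !derive1E; split.
    by apply: derivableP; exact: (xs 0%N).
  by apply: derivableP; exact: (xs 1%N).
have Dy : \forall s \near t, is_derive s (1 : R) y (dy s) /\
    is_derive s (1 : R) dy (derive1 dy s).
  apply: filterS sy => s ys; rewrite /dy !derive1E; split.
    by apply: derivableP; exact: (ys 0%N).
  by apply: derivableP; exact: (ys 1%N).
have unit_speed : \forall s \near t, dx s ^+ 2 + dy s ^+ 2 = 1.
  apply: filterS3 cb Dx Dy => s [_ us] [[Dxs _] _] [[Dys _] _].
  have dc : derivable c s 1.
    apply/derivable_mxP => i j; rewrite ord1.
    have [->|->] := ord2_cases j; first exact: Dxs.
    exact: Dys.
  by move: us; rewrite derive_mx // inner1 !mxE -!expr2 /dx /dy !derive1E.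
have orth : \forall s \near t, x s * dx s + y s * dy s = 0.
  apply: filterS3 (nbhs_interior xy) Dx Dy => s xys [D1 _] [D2 _].
  have D := is_derive_addf (is_derive_mulf D1 D1) (is_derive_mulf D2 D2).
  have near_const : \forall u \near s, x u * x u + y u * y u = r ^+ 2.
    by apply: filterS xys => u; rewrite !expr2.
  have [_ Z] := near_eq_is_derive near_const D.
  have [_ Z'] := is_derive_constf (r ^+ 2) s (1 : R).
  by have := etrans (esym Z) Z'; lra.
pose w s := x s * dy s - y s * dx s.
have ww : \forall s \near t, w s ^+ 2 = r ^+ 2.
  apply: filterS3 xy unit_speed orth => s e1 e2 e3.
  apply/eqP; rewrite -[r ^+ 2]mulr1 -e1 -e2 -subr_eq0.
  rewrite (_ : _ - _ = - (x s * dx s + y s * dy s) ^+ 2); last by rewrite /w; ring.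
  by rewrite e3 expr0n oppr0.
have wt : w t ^+ 2 = r ^+ 2 by exact: nbhs_singleton ww.
have wn : w t != 0 by rewrite -sqrf_eq0 wt sqrf_eq0.
have Dw : \forall s \near t, is_derive s (1 : R) w (x s * derive1 dy s - y s * derive1 dx s).
  apply: filterS2 Dx Dy => s [D1 D1'] [D2 D2'].
  have D := is_derive_subf (is_derive_mulf D1 D2') (is_derive_mulf D2 D1').
  move: {D1 D1' D2 D2'} D.
  move: (derive1 dx s) (derive1 dy s) (dx s) (dy s) (x s) (y s) => a b a' b' u v D.
  by rewrite (_ : u * b - _ = a' * b' + u * b - (b' * a' + v * a)) //; ring.
have wc : \forall s \near t, w s = w t.
  have cw : {for t, continuous w}.
    exact: is_derive_continuous (nbhs_singleton Dw).
  (* The other root [w s = - w t] would be at distance [2 r] from [w t]. *)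
  have w2 : \forall s \near t, `|w t - w s| < r.
    by move/cvgrPdist_lt : cw; apply.
  apply: filterS2 ww w2 => s e1 e2.
  have : (w s - w t) * (w s + w t) = 0 by rewrite -subr_sqr e1 wt subrr.
  move/eqP; rewrite mulf_eq0 => /orP[|]; first by rewrite subr_eq0 => /eqP.
  rewrite addr_eq0 => /eqP ws; exfalso.
  move: e2; rewrite ws opprK -mulr2n normrMn -(sqrtr_sqr (w t)) wt sqrtr_sqr.
  by rewrite ger0_norm ?(ltW r0) // -mulr_natr; have := r0; lra.
pose e := w t / r.
have e1 : e ^+ 2 = 1 by rewrite exprMn wt -exprMn divff // expr1n.
(* [(P, Q)] is the curve turned back by the angle [e s / r]. It is locally constant, and the angle
   of its constant value is [th]. *)
pose P s := x s * cos (e / r * s) + y s * sin (e / r * s).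
pose Q s := y s * cos (e / r * s) - x s * sin (e / r * s).
have lin : \forall s \near t, dx s = - (e / r) * y s /\ dy s = (e / r) * x s.
  apply: filterS3 xy orth wc => s h1 h3 h4.
  have rr : r ^+ 2 != 0 by rewrite sqrf_eq0.
  have er : e / r * r ^+ 2 = w t by rewrite /e; field.
  split; apply: (mulfI rr).
    rewrite mulrA mulrN [r ^+ 2 * (e / r)]mulrC er -h4 /w -h1.
    rewrite -[LHS]subr0 -(mulr0 (x s)) -h3; ring.
  rewrite [RHS]mulrA [r ^+ 2 * (e / r)]mulrC er -h4 /w -h1.
  rewrite -[LHS]subr0 -(mulr0 (y s)) -h3; ring.
have DPQ : \forall s \near t, is_derive s (1 : R) P 0 /\ is_derive s (1 : R) Q 0.
  apply: filterS3 lin Dx Dy => s [l1 l2] [D1 _] [D2 _].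
  have Dc := is_derive_cos_scale (e / r) s; have Ds := is_derive_sin_scale (e / r) s.
  split.
    have := is_derive_addf (is_derive_mulf D1 Dc) (is_derive_mulf D2 Ds).
    by rewrite l1 l2 [X in is_derive _ _ _ X -> _](_ : _ = 0) //; ring.
  have := is_derive_subf (is_derive_mulf D2 Dc) (is_derive_mulf D1 Ds).
  by rewrite l1 l2 [X in is_derive _ _ _ X -> _](_ : _ = 0) //; ring.
have Pc : \forall s \near t, P s = P t.
  by apply: near_derive0_constant; apply: filterS DPQ => s [].
have Qc : \forall s \near t, Q s = Q t.
  by apply: near_derive0_constant; apply: filterS DPQ => s [].
have [th /rowP thE] : exists th, (\row_(j < 2) if j == ord0 then P t else Q t) = polar r th.
  apply: polar_surj; first exact: ltW.
  have xyt : x t ^+ 2 + y t ^+ 2 = r ^+ 2 by exact: nbhs_singleton xy.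
  rewrite /sqnorm !mxE /= -xyt /P /Q -[RHS]mulr1 -(cos2Dsin2 (e / r * t)); ring.
have thP : P t = r * cos th by have := thE ord0; rewrite !mxE.
have thQ : Q t = r * sin th by have := thE ord_max; rewrite !mxE.
exists e, th; split=> //; apply: filterS2 Pc Qc => s p1 q1.
have E : e * s / r + th = e / r * s + th by rewrite mulrAC.
have cs := cos2Dsin2 (e / r * s).
apply: row2P.
  rewrite polar_x E cosD mulrBr mulrCA -thP [r * (_ * _)]mulrCA -thQ -p1 -q1.
  rewrite -/(x s) -[LHS]mulr1 -cs /P /Q; ring.
rewrite polar_y E sinD mulrDr mulrCA -thP [r * (_ * _)]mulrCA -thQ -p1 -q1.
rewrite -/(y s) -[LHS]mulr1 -cs /P /Q; ring.
Qed.

End ArclengthCircle.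

(** * Dirichlet-to-Neumann operators of quotients of disks *)

Section DiskQuotient.
Context {R : realType}.
Implicit Types (r : R) (G : set ('rV[R]_2 -> 'rV[R]_2)) (c : nat -> R * R * nat).

(* Common generalization of flat_disk and flat_cone: both are convertible to
   instances of it. *)
Definition disk_quotient (T : topologicalType) (S : set T) r G
    (proj : 'rV[R]_2 -> T) : orbisurface R :=
  @Orbisurface R T S unit (fun=> disk_chart r G) (fun=> proj).

Definition descend (T : Type) (proj : 'rV[R]_2 -> T) (U : Type)
    (f : 'rV[R]_2 -> U) (p : T) : U :=
  f (xget 0 [set x | proj x = p]).

Lemma descendE (T : Type) (proj : 'rV[R]_2 -> T) (U : Type) (f : 'rV[R]_2 -> U) x :
  (forall x y, proj x = proj y -> f x = f y) -> descend proj f (proj x) = f x.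
Proof.
by move=> pf; apply: pf; apply: (@xgetPex _ 0 [set y | proj y = proj x]); exists x.
Qed.

Lemma derivable_iter_is_derive (f : R -> R) :
  (forall t n, derivable (derive1n n f) t 1) ->
  forall n t, is_derive t (1 : R) (derive1n n f) (derive1n n.+1 f t).
Proof.
by move=> df n t; rewrite derive1nS derive1E; apply: derivableP; exact: df.
Qed.

Section Quotient.
Context (T : topologicalType) (S : set T) (r : R)
  (G : set ('rV[R]_2 -> 'rV[R]_2)) (proj : 'rV[R]_2 -> T).
Hypothesis r0 : 0 < r.

Let O := disk_quotient S r G proj.
Let C := disk_chart r G.

Lemma quotient_bdE p : os_bd O p <-> exists t, p = proj (polar r t).
Proof.
split=> [[i [x /(disk_bdE) xr <-]]|[t ->]].
  by have [t ->] := polar_surj (ltW r0) xr; exists t.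
by exists tt, (polar r t) => //; apply/disk_bdE; rewrite sqnorm_polar.
Qed.

(** Every arc-length curve is locally an affine reparametrisation of the standard one, so smoothness
    along all curves is smoothness of one function on the line. For the cone and the disk this will
    be the same function. *)
Lemma smooth_bd_quotient u : smooth_bd (O := O) u <->
  forall t n, derivable (derive1n n (fun s => u (proj (polar r (s / r))))) t 1.
Proof.
set V := fun s => u (proj (polar r (s / r))).
split=> [su t|sV [] c t ct].
  have VE : u \o proj \o (fun s => polar r (1 * s / r + 0)) = V.
    by apply/funext => s /=; rewrite mul1r addr0.
  have H : smooth_near (u \o proj \o (fun s => polar r (1 * s / r + 0))) t.
    exact: (su tt _ t (@circle_arclength _ r G r0 1 0 t (expr1n _ 2))).
  by rewrite VE in H; exact: nbhs_singleton H.
have [e [th [e1 cE]]] := arclength_circle r0 ct.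
have en : e != 0 by apply/eqP => e0; move: e1; rewrite e0 expr0n => /eqP; rewrite eq_sym oner_eq0.
have dV := derivable_iter_is_derive sV.
apply: (@smooth_near_of _ (fun n s => e ^+ n * derive1n n V (e * s + r * th))).
  move=> n s; rewrite exprSr -mulrA [e * _]mulrC.
  apply: is_derive_scalef.
  exact: (@is_derive_compf _ (derive1n n V) (fun s => e * s + r * th) _ _ _
    (dV n (e * s + r * th)) (is_derive_affine e (r * th) s)).
apply: filterS cE => s cs; rewrite /= expr0 mul1r cs /V.
by rewrite mulrDl [r * th]mulrC mulfK // gt_eqF.
Qed.

Variable c : nat -> R * R * nat.
Hypothesis rc : rapid c.
Hypothesis proj_cpow : forall x y, proj x = proj y ->
  forall n, cpow (c n).2 (r^-1 *: x) = cpow (c n).2 (r^-1 *: y).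

(** The series descends to the quotient because its powers are constant on the fibres of [proj]. By
    uniqueness, the extension selected by [get] agrees with it on the disk, hence has the same
    normal derivative. *)
Lemma dn_quotient u : (forall x, ch_bd C x -> u (proj x) = hsum c (r^-1 *: x)) ->
  forall x, ch_bd C x ->
    dn_operator (O := O) u (proj x) = r^-1 * hsum (euler c) (r^-1 *: x).
Proof.
move=> uc x xb; rewrite /dn_operator.
pose f := descend proj (fun x => hsum c (r^-1 *: x)).
have proj_hsum (d : nat -> R * R * nat) y z : (forall n, (d n).2 = (c n).2) ->
    proj y = proj z -> hsum d (r^-1 *: y) = hsum d (r^-1 *: z).
  move=> dc yz; rewrite /hsum; congr (limn (series _)); apply/funext => n.
  by rewrite /hterm dc (proj_cpow yz).
have fE y : f (proj y) = hsum c (r^-1 *: y).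
  by rewrite /f descendE // => *; exact: proj_hsum.
have hf : harmonic_extension (O := O) u f.
  split=> [i|i y yI|p [i [y yb <-]]].
  - by apply: smooth_hsum rc _ => // y yD; exact: fE.
  - by apply: (hsum_harmonic r0 rc) yI => z zD; exact: fE.
  - by rewrite fE uc.
have := @getPex _ [set f | harmonic_extension (O := O) u f] (ex_intro _ f hf).
set Hu := get _ => -[/= sHu lHu bHu].
have HuE y : ch_dom C y -> Hu (proj y) = hsum c (r^-1 *: y).
  rewrite -fE; apply: (harmonic_unique r0 (f := Hu \o proj) (g := f \o proj)).
  - exact: (sHu tt).
  - by case: hf => /(_ tt).
  - exact: (lHu tt).
  - by case: hf => _ /(_ tt).
  - move=> z zb /=; have zB : os_bd O (proj z) by exists tt, z.
    by rewrite bHu //; case: hf => _ _ ->.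
have nd y : ch_bd C y ->
    normal_derivative C (Hu \o proj) y = r^-1 * hsum (euler c) (r^-1 *: y).
  by move=> yb; apply: (hsum_normal_derivative r0 rc) yb.
(* The candidates come from all boundary points above [proj x]. They yield one value, since
   [euler c] has the exponents of [c] and is constant on fibres as well. *)
set D := [set d | _].
have : D (get D).
  by apply: getPex; exists (normal_derivative C (Hu \o proj) x), tt, x.
move=> [i [y [yb yx] ->]]; rewrite nd //; congr (_ * _).
exact: proj_hsum.
Qed.

End Quotient.

Lemma orbit_mapP k (x y : 'rV[R]_2) : orbit_map k x = orbit_map k y <->
  exists2 a, cyclic_rotations k a & y = a x.
Proof.
have E : reflect (orbit_map k x = orbit_map k y) (same_orbit k x y).
  exact: (@eqmodP _ (orbit_equiv k) x y).
by split=> [/E/asboolP|xy]; [|apply/E/asboolP].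
Qed.

Definition power_map k (x : 'rV[R]_2) : 'rV[R]_2 :=
  \row_(j < 2) (if j == ord0 then (cpow k x).1 else (cpow k x).2).

Lemma power_map_polar k rho t :
  power_map k (polar rho t) = polar (rho ^+ k) (k%:R * t).
Proof. by apply: row2P; rewrite mxE cpow_polar ?polar_x ?polar_y. Qed.

(* The isometry of the boundaries: the orbit of [k e^{i t}] goes to [e^{i k t}]. *)
Definition cone_to_disk k : orbit_space k -> 'rV[R]_2 :=
  descend (orbit_map k) (fun x => power_map k (k%:R^-1 *: x)).

Lemma polar_exists (x : 'rV[R]_2) : exists rho t, 0 <= rho /\ x = polar rho t.
Proof.
have [t ->] := polar_surj (sqrtr_ge0 (sqnorm x)) (esym (sqr_sqrtr (sqnorm_ge0 x))).
by exists (Num.sqrt (sqnorm x)), t; rewrite sqrtr_ge0.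
Qed.

Lemma rotationZ (s a : R) (x : 'rV[R]_2) : s *: rotation a x = rotation a (s *: x).
Proof.
by have [rho [t [_ ->]]] := polar_exists x; rewrite rotation_polar !polarZ rotation_polar.
Qed.

(** The exponent [k n] turns a rotation by [2 pi m / k] into [m n] full turns. *)
Lemma cpow_orbit k n (x y : 'rV[R]_2) : (0 < k)%N -> orbit_map k x = orbit_map k y ->
  cpow (k * n) x = cpow (k * n) y.
Proof.
move=> k0 /orbit_mapP[_ [m ->] ->].
have [rho [t [_ ->]]] := polar_exists x; rewrite rotation_polar !cpow_polar.
have -> : (k * n)%N%:R * (m%:~R * (2 * pi / k%:R) + t) =
    (k * n)%N%:R * t + (m * n%:Z)%:~R * (2 * pi).
  rewrite natrM intrM; field; by rewrite pnatr_eq0 -lt0n.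
by rewrite cos_int2pi sin_int2pi.
Qed.

Lemma orbit_mapZ k (s : R) (x y : 'rV[R]_2) : orbit_map k x = orbit_map k y ->
  orbit_map k (s *: x) = orbit_map k (s *: y).
Proof.
move=> /orbit_mapP[_ [m ->] ->]; apply/orbit_mapP.
by exists (rotation (m%:~R * (2 * pi / k%:R))); [exists m|exact: rotationZ].
Qed.

Lemma cone_to_diskE k x : (0 < k)%N ->
  cone_to_disk (orbit_map k x) = power_map k (k%:R^-1 *: x).
Proof.
move=> k0; rewrite /cone_to_disk descendE // => y z yz; rewrite /power_map.
by have := cpow_orbit 1 k0 (orbit_mapZ k%:R^-1 yz); rewrite muln1 => ->.
Qed.

(** Equal powers have equal moduli and arguments that differ by a multiple of [2 pi / k]; the origin
    is separate, its argument being undetermined. *)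
Lemma power_map_inj k x y : (0 < k)%N -> power_map k x = power_map k y ->
  orbit_map k x = orbit_map k y.
Proof.
move=> k0; have kn : k%:R != 0 :> R by rewrite pnatr_eq0 -lt0n.
have [rho [t [r0 ->]]] := polar_exists x.
have [rho' [t' [r0' ->]]] := polar_exists y.
rewrite !power_map_polar => e.
have re : rho = rho'.
  have := congr1 (@sqnorm R) e; rewrite !sqnorm_polar -!exprM => /eqP.
  by rewrite eqrXn2 ?muln_gt0 ?k0 // => /eqP.
apply/orbit_mapP; rewrite -re in e *.
have [r00|rn] := eqVneq rho 0.
  exists (rotation (0%:~R * (2 * pi / k%:R))); first by exists 0.
  by rewrite rotation_polar; apply: row2P; rewrite ?polar_x ?polar_y r00 !mul0r.
have rp : 0 < rho ^+ k by rewrite exprn_gt0 // lt_neqAle eq_sym rn.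
have [m km] := (polar_eq _ _ rp).1 (esym e).
exists (rotation (m%:~R * (2 * pi / k%:R))); first by exists m.
rewrite rotation_polar; congr polar; apply: (mulfI kn); rewrite km.
by field.
Qed.

(** Injectivity holds beyond the boundary: the Hausdorff property of the orbit space and the
    transport of eigenfunctions rely on it. *)
Lemma cone_to_disk_inj k : (0 < k)%N -> injective (@cone_to_disk k).
Proof.
move=> k0 p q; have kn : k%:R != 0 :> R by rewrite pnatr_eq0 -lt0n.
have [x <-] : exists x, orbit_map k x = p by exists (repr p); exact: reprK.
have [y <-] : exists y, orbit_map k y = q by exists (repr q); exact: reprK.
rewrite !cone_to_diskE // => /(power_map_inj k0) /(@orbit_mapZ k k%:R).
by rewrite !scalerA divff // !scale1r.
Qed.

Lemma cone_to_disk_bd k t : (0 < k)%N ->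
  cone_to_disk (orbit_map k (polar k%:R t)) = polar 1 (k%:R * t).
Proof.
move=> k0; rewrite cone_to_diskE // polarZ mulVf ?pnatr_eq0 -?lt0n //.
by rewrite power_map_polar expr1n.
Qed.

Lemma smooth_bd_cone k (u : 'rV[R]_2 -> R) : (0 < k)%N ->
  smooth_bd (O := flat_cone k k%:R) (u \o @cone_to_disk k) <->
  smooth_bd (O := flat_disk 1) u.
Proof.
move=> k0; have kp : 0 < k%:R :> R by rewrite ltr0n.
have H1 := @smooth_bd_quotient _ (orbit_map k @` [set x | disk_rho k%:R x <= 0])
  k%:R (cyclic_rotations k) (orbit_map k) kp (u \o @cone_to_disk k).
have H2 := @smooth_bd_quotient _ [set x | disk_rho 1 x <= 0] 1 [set id] id ltr01 u.
apply: (iff_trans H1); apply: iff_trans (iff_sym H2).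
rewrite (_ : (fun s => (u \o @cone_to_disk k) (orbit_map k (polar k%:R (s / k%:R)))) =
  (fun s => u (id (polar 1 (s / 1))))); first exact: iff_refl.
apply/funext => s; rewrite /= cone_to_disk_bd // divr1 mulrC divfK //.
by rewrite gt_eqF.
Qed.

Lemma hterm_polar1 (a b : R) n t : hterm (a, b, n) (polar 1 t) =
  a * cos (n%:R * t) + b * sin (n%:R * t).
Proof. by rewrite /hterm /= cpow_polar expr1n !mul1r. Qed.

(* If u (e^{i s}) = sum_n a_n cos (n s) + b_n sin (n s), the coefficients (a_n, b_n)
   with exponents n, resp. k n, give the harmonic extensions of u to the disk and
   of u o cone_to_disk to the cone. *)
Theorem dn_cone k (u : 'rV[R]_2 -> R) : (0 < k)%N ->
  smooth_bd (O := flat_disk 1) u ->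
  forall p : orbit_space k, os_bd (flat_cone k k%:R) p ->
    dn_operator (O := flat_cone k k%:R) (u \o @cone_to_disk k) p =
    dn_operator (O := flat_disk 1) u (cone_to_disk p).
Proof.
move=> k0 su; have kp : 0 < k%:R :> R by rewrite ltr0n.
have kn : k%:R != 0 :> R by rewrite gt_eqF.
have sV := (@smooth_bd_quotient _ [set x | disk_rho 1 x <= 0] 1 [set id] id ltr01 u).1 su.
pose V s := u (polar 1 s).
have VE : (fun s => u (id (polar 1 (s / 1)))) = V by apply/funext => s; rewrite divr1.
rewrite VE in sV.
have dV := derivable_iter_is_derive sV.
have pV n : periodic2pi (derive1n n V).
  elim: n => [|n IH] t.
    rewrite /= /V; congr u; apply/(polar_eq _ _ ltr01); exists 1.
    by rewrite mul1r.
  have [_ <-] := dV n t; have [_ <-] := dV n (t + 2 * pi).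
  have D := is_derive_translate (dV n (t + 2 * pi)).
  rewrite (_ : (fun s => derive1n n V (s + 2 * pi)) = derive1n n V) in D; last first.
    by apply/funext => s; exact: IH.
  have [_ ->] := dV n (t + 2 * pi).
  by have [_ ->] := D.
have [a [b [decay fs]]] := fourier_expansion dV pV.
(* One coefficient sequence with exponents dilated by [d]: [d = 1] is the disk, [d = k] the cone. *)
pose c d n : R * R * nat := (a n, b n, (d * n)%N).
have rc d : (0 < d)%N -> rapid (c d).
  move=> d0 j; apply: (@cvg_series_rapid _ (fun n => `|a n| + `|b n|) _ d) => //.
have cV d t : hsum (c d) (polar 1 t) = V (d%:R * t).
  apply/cvg_lim => //; rewrite (_ : (fun n => _) = fun n =>
    a n * cos (n%:R * (d%:R * t)) + b n * sin (n%:R * (d%:R * t))); first exact: fs.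
  apply/funext => n; rewrite hterm_polar1 natrM.
  by rewrite (_ : d%:R * n%:R * t = n%:R * (d%:R * t)) //; ring.
have bd (r : R) G x : 0 < r -> ch_bd (disk_chart r G) x -> exists t, x = polar r t.
  by move=> r0 /disk_bdE; exact: polar_surj (ltW r0).
move=> p /(quotient_bdE kp)[t ->].
rewrite cone_to_disk_bd //.
have tb (r s : R) G : ch_bd (disk_chart r G) (polar r s).
  by apply/disk_bdE; rewrite sqnorm_polar.
have inv_cone (x y : 'rV[R]_2) : orbit_map k x = orbit_map k y -> forall n,
    cpow (c k n).2 (k%:R^-1 *: x) = cpow (c k n).2 (k%:R^-1 *: y).
  by move=> xy n; exact: (cpow_orbit n k0 (orbit_mapZ k%:R^-1 xy)).
have ext_cone x : ch_bd (disk_chart k%:R (cyclic_rotations k)) x ->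
    (u \o @cone_to_disk k) (orbit_map k x) = hsum (c k) (k%:R^-1 *: x).
  by move=> /(bd _ _ _ kp)[s ->] /=; rewrite cone_to_disk_bd // polarZ mulVf // cV.
have ext_disk x : ch_bd (disk_chart 1 [set id]) x -> u x = hsum (c 1%N) (1^-1 *: x).
  by move=> /(bd _ _ _ ltr01)[s ->]; rewrite polarZ invr1 mulr1 cV mul1r.
apply: (etrans (dn_quotient _ kp (rc _ k0) inv_cone ext_cone (tb _ _ _))).
have inv_disk (x y : 'rV[R]_2) : id x = id y -> forall n,
    cpow (c 1%N n).2 (1^-1 *: x) = cpow (c 1%N n).2 (1^-1 *: y) by move=> ->.
apply/esym; apply: (etrans (dn_quotient (proj := id) _ ltr01 (rc _ (ltn0Sn 0))
  inv_disk ext_disk (tb _ _ _))); apply/esym.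
rewrite !polarZ mulVf // invr1 !mul1r.
have re : rapid (euler (c 1%N)).
  move=> j; rewrite (_ : (fun n => _) =
    (fun n => (c 1%N n).2%:R ^+ j.+1 * hterm_size (c 1%N n))); first exact: rc.
  apply/funext => n; rewrite /hterm_size /euler /= !normrM ger0_norm ?ler0n //.
  by rewrite -mulrDr mulrA exprSr.
have ce : sqnorm (polar 1 (k%:R * t)) <= 1 :> R by rewrite sqnorm_polar expr1n.
rewrite /hsum (_ : (fun n => hterm (euler (c k) n) (polar 1 t)) =
  k%:R \*: (fun n => hterm (euler (c 1%N) n) (polar 1 (k%:R * t)))); last first.
  apply/funext => n; rewrite /euler hterm_polar1 /= mul1n natrM /GRing.scale /= hterm_polar1.
  have -> : k%:R * n%:R * t = n%:R * (k%:R * t) by ring.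
  ring.
rewrite (lim_seriesZ _ (hsum_cvg re ce)).
by rewrite /GRing.scale /= mulKf.
Qed.

End DiskQuotient.

(** * The length of the boundary of a cone *)

Section ConeBoundary.
Context {R : realType} (k : nat).
Hypothesis k0 : (0 < k)%N.
Implicit Types (r s t : R).

Let kp : 0 < k%:R :> R. Proof. by rewrite ltr0n. Qed.
Let kn : k%:R != 0 :> R. Proof. by rewrite gt_eqF. Qed.
Let pi2 : 0 < 2 * pi :> R. Proof. by rewrite mulr_gt0 // pi_gt0. Qed.
Let pi2n : 2 * pi != 0 :> R. Proof. by rewrite gt_eqF. Qed.

Lemma orbit_polar_eq r s t : 0 < r ->
  orbit_map k (polar r s) = orbit_map k (polar r t) <->
  exists m : int, t = s + m%:~R * (2 * pi / k%:R).
Proof.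
move=> r0; split=> [/orbit_mapP[_ [m ->]]|[m ->]].
  rewrite rotation_polar => /(polar_eq _ _ r0)[n ->].
  exists (m + n * k%:Z); rewrite intrD intrM; field.
  by rewrite kn.
apply/orbit_mapP; exists (rotation (m%:~R * (2 * pi / k%:R))); first by exists m.
by rewrite rotation_polar addrC.
Qed.

Lemma cone_boundary_length : boundary_circle_of_length (flat_cone k (k%:R : R)) (2 * pi).
Proof.
exists (fun t => orbit_map k (polar k%:R (t / k%:R))); split=> [|s t|t].
- apply/seteqP; split=> [_ [t _ <-]|p /(quotient_bdE kp)[t ->]].
    by apply/(quotient_bdE kp); exists (t / k%:R).
  by exists (t * k%:R) => //; rewrite mulfK.
- rewrite orbit_polar_eq //; split=> [[m e]|[m ->]]; exists m.
    by apply: (mulIf (invr_neq0 kn)); rewrite e; field.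
  by field.
- exists tt, (fun s => polar k%:R (1 * s / k%:R + 0)).
    by apply: circle_arclength => //; rewrite expr1n.
  by near=> s; rewrite mul1r addr0.
Unshelve. all: by end_near. Qed.

(** The difference [f] of the two angles is affine and, near [s], takes values in the discrete set
    of multiples of [2 pi / k]. It is thus locally constant, its slope is 0, and the equality holds
    everywhere. *)
Lemma orbit_polar_near_eq r (e e' th th' : R) s : 0 < r ->
  (\forall u \near s, orbit_map k (polar r (e * u / r + th)) =
                      orbit_map k (polar r (e' * u / r + th'))) ->
  forall u, orbit_map k (polar r (e * u / r + th)) =
            orbit_map k (polar r (e' * u / r + th')).
Proof.
move=> r0 nE; have rn : r != 0 by rewrite gt_eqF.
pose f u := (e' - e) / r * u + (th' - th).
pose q : R := 2 * pi / k%:R.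
have q0 : 0 < q by rewrite divr_gt0.
have fE u : orbit_map k (polar r (e * u / r + th)) =
    orbit_map k (polar r (e' * u / r + th')) <-> exists m : int, f u = m%:~R * q.
  rewrite orbit_polar_eq //; split=> -[m E]; exists m.
    by rewrite /f -[RHS](addKr (e * u / r + th)) -E; field.
  by rewrite -/q -E /f; field.
have [m0 fs] := (fE s).1 (nbhs_singleton nE).
have fc : \forall u \near s, `|f s - f u| < q.
  have : {for s, continuous f} := is_derive_continuous (is_derive_affine _ _ s).
  by move/cvgrPdist_lt; apply.
have fss : \forall u \near s, f u = f s.
  apply: filterS2 nE fc => u /fE[m fu]; rewrite fs fu -mulrBl normrM.
  rewrite (gtr0_norm q0) gtr_pMl // -intrB -intr_norm ltrz1 => mm.
  suff : m0 - m = 0 by move/eqP; rewrite subr_eq0 => /eqP ->.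
  by move: mm; case: (m0 - m) => [[|n]|n].
have [d /= d0 dP] := fss.
have : f (s + d / 2) = f s.
  apply: dP => /=; rewrite opprD addrA subrr add0r normrN gtr0_norm ?divr_gt0 //.
  by rewrite ltr_pdivrMr // ltr_pMr // ltr1n.
have ee : f (s + d / 2) - f s = (e' - e) / r * (d / 2) by rewrite /f; ring.
move=> ff; have slope : (e' - e) / r = 0.
  move: ee; rewrite ff subrr => /esym/eqP.
  by rewrite mulf_eq0 [d / 2 == 0]gt_eqF ?divr_gt0 // orbF => /eqP.
by move=> u; apply/fE; exists m0; rewrite -fs /f slope !mul0r.
Qed.

(* The boundary curve of length 2 pi agrees locally with an arc of constant speed
   +-1 on the circle of radius r, hence globally because R is connected; its
   exact period then forces r = k. *)
Lemma cone_radius r : 0 < r ->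
  boundary_circle_of_length (flat_cone k r) (2 * pi) -> r = k%:R.
Proof.
move=> r0 [g [_ gE gl]]; have rn : r != 0 by rewrite gt_eqF.
have loc t : exists e th, e ^+ 2 = 1 /\
    \forall s \near t, g s = orbit_map k (polar r (e * s / r + th)).
  have [[] [c ct gc]] := gl t; have [e [th [e1 cE]]] := arclength_circle r0 ct.
  by exists e, th; split=> //; apply: filterS2 gc cE => s -> /= ->.
have [e [th [e1 gE0]]] := loc 0.
pose A := [set t : R | \forall s \near t, g s = orbit_map k (polar r (e * s / r + th))].
have oA : open A by rewrite openE => t /nbhs_interior.
(* If points of [A] came arbitrarily near [t], the arc describing [g] near [t] would agree with the
   given one near such a point, hence everywhere, and [t] would lie in [A]. *)
have cA : closed A.
  rewrite -openC openE => t tA; have [e' [th' [_ gE']]] := loc t.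
  apply: filterS (nbhs_interior gE') => s gs sA; apply: tA.
  have H := @orbit_polar_near_eq r e e' th th' s r0.
  apply: filterS gE' => u ->; apply/esym; apply: H.
  by apply: filterS2 sA gs => v -> ->.
have cR : connected [set: R] by apply/connected_intervalP => x y _ _ z _.
have AT : A = setT.
  by apply: cR; [exists 0|exists A; rewrite ?setTI|exists A; rewrite ?setTI].
have {gE0} gall s : g s = orbit_map k (polar r (e * s / r + th)).
  have : A s by rewrite AT.
  exact: nbhs_singleton.
have [z ez] : exists z : int, e = z%:~R.
  move/eqP: e1; rewrite sqrf_eq1 => /orP[]/eqP->; [by exists 1|by exists (-1)].
(* [2 pi] is a period of the curve, so [e (2 pi) / r] is a multiple [m] of [2 pi / k]. *)
have [m] := (orbit_polar_eq _ _ r0).1 (etrans (esym (gall 0)) (etrans ((gE 0 (2 * pi)).2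
  (ex_intro _ 1 (esym (etrans (congr1 (fun x => 0 + x) (mul1r (2 * pi))) (add0r _)))))
  (gall (2 * pi)))).
rewrite mulr0 mul0r add0r addrC => /addrI em.
(* Conversely [2 pi r / k], the length of one turn around the cone, is a period, so it is a multiple
   [m'] of [2 pi]. *)
have [m' rm] : exists m' : int, r = m'%:~R * k%:R.
  have [|m' mE] := (gE 0 (r * (2 * pi) / k%:R)).1.
    rewrite !gall; apply/(orbit_polar_eq _ _ r0); exists z.
    by rewrite -ez; field; rewrite kn.
  exists m'; rewrite add0r in mE.
  by apply: (mulIf pi2n); rewrite mulrAC -mE divfK.
(* The two relations give [e k = m r = m m' k]. As [e] is 1 or -1 and [m'] is positive, [m' = 1]. *)
have zm : z = m * m'.
  apply: (@intr_inj R); rewrite intrM -ez.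
  have : e * (2 * pi) * k%:R = m%:~R * (2 * pi) * r.
    rewrite (_ : e * (2 * pi) * k%:R = e * (2 * pi) / r * r * k%:R); last by field.
    by rewrite em; field.
  rewrite rm => E; apply: (mulIf kn); apply: (mulIf pi2n).
  rewrite mulrAC E; ring.
have m'p : 0 < m' by rewrite -(ltr0z R) -(pmulr_lgt0 _ kp) -rm.
have zz : `|z|%N = 1%N.
  have : z ^+ 2 = 1 by apply: (@intr_inj R); rewrite rmorphXn /= -ez e1.
  by move/eqP; rewrite sqrf_eq1 => /orP[]/eqP->.
have : (`|m'|%N %| 1)%N by rewrite -zz zm abszM dvdn_mull.
rewrite dvdn1 => /eqP m'1; rewrite rm -(gez0_abs (ltW m'p)) m'1.
by rewrite mul1r.
Qed.

End ConeBoundary.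

(** * Orbifold structures *)

Section SmoothPlane.
Context {R : realType}.
Implicit Types (U D V : set 'rV[R]_2) (f g : 'rV[R]_2 -> R) (x v : 'rV[R]_2).

Lemma smooth_upto_const U D (c : R) : smooth_upto U D (fun=> c).
Proof.
exists (fun s _ => if s is [::] then c else 0); split=> // [s|s i x _].
  by apply: continuous_subspaceT; case: s => *; exact: cst_continuous.
by case: s => *; exact: is_derive_constf.
Qed.

Lemma smooth_upto_step U D f (g : 'I_2 -> 'rV[R]_2 -> R) :
  U `<=` D -> {within D, continuous f} ->
  (forall i x, U x -> is_derive x (basis_vec i) f (g i x)) ->
  (forall i, smooth_upto U D (g i)) -> smooth_upto U D f.
Proof.
move=> UD cf df sg.
pose F i := projT1 (cid (sg i)); pose FP i := projT2 (cid (sg i)).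
(* [F (i :: s)] is a derivative of [F s], so the derivative taken first is the last letter of a
   word: it selects [g], and the other letters are passed to the witness of [g]. *)
exists (fun s => if s is j :: s' then F (last j s') (belast j s') else f).
split=> // [[//|j s]|[|j s] i x Ux].
- by have [_ + _] := FP (last j s); exact.
- have [Fe _ _] := FP i; rewrite /= /F Fe; [exact: df|exact: UD].
- by have [_ _ +] := FP (last j s); exact.
Qed.

Lemma continuous_affine_rV (a b : R) : continuous (fun x : 'rV[R]_2 => a * xc x + b * yc x).
Proof.
have c (d : R) j x : {for x, continuous (fun z : 'rV[R]_2 => d * z 0 j)}.
  by apply: (@continuousM _ _ (fun=> d) (fun z : 'rV[R]_2 => z 0 j));
    [exact: cst_continuous|exact: coord_continuous].
by move=> x; exact: (continuousD (c a ord0 x) (c b ord_max x)).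
Qed.

Lemma is_derive_linear_rV (a b : R) x v :
  is_derive x v (fun x => a * xc x + b * yc x) (a * xc v + b * yc v).
Proof. by apply: is_derive_affine_line => h; rewrite !mxE /GRing.scale /=; ring. Qed.

Lemma smooth_upto_linear U D (a b : R) : U `<=` D ->
  smooth_upto U D (fun x => a * xc x + b * yc x).
Proof.
move=> UD; apply: (@smooth_upto_step _ _ _
  (fun i _ => a * xc (basis_vec i) + b * yc (basis_vec i))) => //.
- by apply: continuous_subspaceT; exact: continuous_affine_rV.
- by move=> i x _; exact: is_derive_linear_rV.
- by move=> i; exact: smooth_upto_const.
Qed.

Lemma smooth_disk_rho U (r : R) : smooth_upto U U (disk_rho r).
Proof.
apply: (@smooth_upto_step _ _ _
  (fun i x => (2 * xc (basis_vec i)) * xc x + (2 * yc (basis_vec i)) * yc x)) => //.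
- apply: continuous_subspaceT => x.
  by apply: (@continuousB _ _ _ (@sqnorm R) (fun=> r ^+ 2));
    [exact: continuous_sqnorm|exact: cst_continuous].
- move=> i x _.
  have := is_derive_subf (is_derive_sqnorm x (basis_vec i))
    (is_derive_constf (r ^+ 2) x (basis_vec i)).
  by congr (is_derive _ _ _ _); ring.
- by move=> i; exact: smooth_upto_linear.
Qed.

Lemma sqnorm_rotation (a : R) x : sqnorm (rotation a x) = sqnorm x.
Proof.
by have [rho [t [_ ->]]] := polar_exists x; rewrite rotation_polar !sqnorm_polar.
Qed.

Lemma rotation_affine (a : R) x v (h : R) :
  rotation a (x + h *: v) = rotation a x + h *: rotation a v.
Proof. by apply: row2P; rewrite !mxE /=; ring. Qed.

Lemma rotation_local_isometry (r a : R) G V :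
  local_isometry (disk_chart r G) (disk_chart r G) V (rotation a).
Proof.
have rhoE x : disk_rho r (rotation a x) = disk_rho r x.
  by have := sqnorm_rotation a x; rewrite /disk_rho /sqnorm => ->.
have D v x : 'D_v (rotation a) x = rotation a v.
  by have [] := is_derive_affine_line (rotation_affine a x v).
split=> [j|x _ [_ xr]|x _ _|x _ _ v w].
- have UD : V `&` ch_int (disk_chart r G) `<=` V `&` ch_dom (disk_chart r G).
    by move=> x [Vx [_ /ltW xr]]; split.
  have [->|->] := ord2_cases j.
    have -> : (fun x => rotation a x 0 ord0) = fun x => cos a * xc x + - sin a * yc x.
      by apply/funext => x; rewrite mxE /= mulNr.
    exact: smooth_upto_linear.
  have -> : (fun x => rotation a x 0 ord_max) = fun x => sin a * xc x + cos a * yc x.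
    by apply/funext => x; rewrite mxE.
  exact: smooth_upto_linear.
- by split=> //=; rewrite rhoE.
- by rewrite /ch_bd /= rhoE.
- rewrite !D !inner1 !mxE /=.
  rewrite -[RHS]mulr1 -(cos2Dsin2 a); ring.
Qed.

(** The disk is a union of segments through the origin. *)
Lemma connected_disk (r : R) : connected [set x : 'rV[R]_2 | sqnorm x <= r].
Proof.
have [r0|r0] := ltP r 0.
  rewrite (_ : mkset _ = set0); first exact: connected0.
  by apply/seteqP; split=> x //=; rewrite leNgt (lt_le_trans r0) ?sqnorm_ge0.
rewrite (_ : mkset _ = \bigcup_(x in [set x : 'rV[R]_2 | sqnorm x <= r])
    ((fun t : R => t *: x) @` `[0, 1])).
  apply: bigcup_connected => [|x xr].
    by exists 0 => x _; exists 0; rewrite ?scale0r //= in_itv /= lexx ler01.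
  apply: connected_continuous_connected; first exact: segment_connected.
  by apply: continuous_subspaceT => t; apply: cvgZr_tmp; exact: cvg_id.
apply/seteqP; split=> [x xr|x [y yr [t]]].
  by exists x => //; exists 1; rewrite ?scale1r //= in_itv /= lexx ler01.
rewrite /= in_itv /= => /andP[t0 t1] <-; rewrite sqnormZ.
by apply: le_trans yr; rewrite ler_piMl ?sqnorm_ge0 // exprn_ile1.
Qed.

Lemma finite_cyclic_rotations k : (0 < k)%N -> finite_set (@cyclic_rotations R k).
Proof.
move=> k0; have kn : k%:R != 0 :> R by rewrite pnatr_eq0 -lt0n.
apply: (@sub_finite_set _ _ ((fun n : nat => rotation (n%:R * (2 * pi / k%:R))) @` `I_k)).
  move=> _ [m ->]; have kz : k%:Z != 0 by rewrite eqz_nat -lt0n.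
  exists `|(m %% k)%Z|%N.
    by rewrite /= -ltz_nat gez0_abs ?modz_ge0 // ltz_pmod.
  apply/funext => x; have [rho [t [_ ->]]] := polar_exists x.
  have mE : m%:~R = (m %/ k)%Z%:~R * k%:R + `|(m %% k)%Z|%N%:R :> R.
    rewrite {1}(divz_eq m k) intrD intrM; congr (_ + _).
    by rewrite -[in LHS](gez0_abs (modz_ge0 m kz)).
  rewrite !rotation_polar mE; apply: row2P; rewrite ?polar_x ?polar_y; congr (_ * _).
    by rewrite -[RHS](cos_int2pi _ (- (m %/ k)%Z)) mulrNz; congr cos; field.
  by rewrite -[RHS](sin_int2pi _ (- (m %/ k)%Z)) mulrNz; congr sin; field.
exact: finite_image.
Qed.

Lemma rotation_chart k (r : R) : (0 < k)%N -> 0 < r ->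
  wf_chart (disk_chart r (cyclic_rotations k)).
Proof.
move=> k0 r0; split; split.
- exact: openT.
- rewrite (_ : ch_dom _ = [set x | sqnorm x <= r ^+ 2]); first exact: connected_disk.
  by apply/seteqP; split=> x /disk_domE.
- exact: smooth_disk_rho.
- move=> x /disk_bdE xr; rewrite disk_gradient scaler_eq0 pnatr_eq0 /=.
  apply/eqP => x0; move: xr; rewrite x0 /sqnorm !mxE expr0n addr0 => /eqP.
  by rewrite eq_sym sqrf_eq0 gt_eqF.
- by move=> i j; exact: smooth_upto_const.
- by move=> x _; rewrite /= trmx1.
- move=> x _ v v0; rewrite inner1 lt_neqAle eq_sym -!expr2 sqnorm_ge0 andbT.
  apply: contra v0; rewrite paddr_eq0 ?sqr_ge0 // !sqrf_eq0 => /andP[/eqP x0 /eqP y0].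
  by apply/eqP; apply: row2P; rewrite ?x0 ?y0 mxE.
- exact: finite_cyclic_rotations.
- exists (rotation (0%:~R * (2 * pi / k%:R))); first by exists 0.
  by move=> x _; rewrite mul0r rotation0.
- move=> _ _ [m ->] [n ->].
  exists (rotation ((m + n)%:~R * (2 * pi / k%:R))); first by exists (m + n).
  by move=> x _; rewrite intrD mulrDl rotationD.
- move=> _ [m ->].
  exists (rotation ((- m)%:~R * (2 * pi / k%:R))); first by exists (- m).
  by move=> x _; rewrite -rotationD -mulrDl -intrD addNr mul0r rotation0.
- by move=> _ [m ->]; exact: rotation_local_isometry.
Qed.

(** The quotient map is abstract, so that the lemma covers the cone and also the disk, with [k = 1]
    and the identity. Transition maps are elements of the group, defined on the whole plane. *)
Lemma rotation_quotient_orbisurface (T : topologicalType) (proj : 'rV[R]_2 -> T) k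
    (r : R) : (0 < k)%N -> 0 < r -> hausdorff_space T -> continuous proj ->
  (forall V, open V -> open (proj @` V)) ->
  (forall x y, proj x = proj y <-> exists2 a, cyclic_rotations k a & y = a x) ->
  compact_riemannian_orbisurface
    (disk_quotient (proj @` [set x | disk_rho r x <= 0]) r (cyclic_rotations k) proj).
Proof.
move=> k0 r0 hT cp op pE.
have DE : [set x : 'rV[R]_2 | disk_rho r x <= 0] = [set x | sqnorm x <= r ^+ 2].
  by apply/seteqP; split=> x /=; rewrite /disk_rho subr_le0.
have domE : ch_dom (disk_chart r (cyclic_rotations k)) = [set x | disk_rho r x <= 0].
  by apply/seteqP; split=> x; [case|split].
split.
- split=> /=; last exact: subspace_hausdorff.
    apply: continuous_compact; first exact: continuous_subspaceT.
    by rewrite DE; exact: compact_disk.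
  apply: connected_continuous_connected; last exact: continuous_subspaceT.
  by rewrite DE; exact: connected_disk.
- by move=> i; exact: rotation_chart.
- split=> /=.
  + move=> p; rewrite domE; split=> [[x xr <-]|[_ [x xr <-]]]; last by exists x.
    by exists tt, x.
  + by move=> i; exact: continuous_subspaceT.
  + move=> i V oV; exists (proj @` V); first exact: op.
    apply/seteqP; split=> [_ [x [Vx [_ xr]] <-]|_ [[x Vx <-] [y yr]]].
      by split; exists x.
    move=> /pE[_ [m ->] xy]; exists x => //; split=> //; rewrite domE /=.
    by move: yr; rewrite /= /disk_rho !subr_le0 -!/(sqnorm _) xy sqnorm_rotation.
  + by move=> i x y _ _; exact: pE.
- move=> i j x y _ _ /pE[a [m aE] ya]; exists setT, a; split=> //.
  + by split=> //; exact: openT.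
  + by rewrite aE; exact: rotation_local_isometry.
  + by move=> z _ _; apply/esym/pE; exists a => //; exists m.
Qed.

End SmoothPlane.

(** * Topology of the cone and comparison of the spectra *)

Section ConeTopology.
Context {R : realType} (k : nat).
Hypothesis k0 : (0 < k)%N.

Let kn : k%:R != 0 :> R. Proof. by rewrite pnatr_eq0 -lt0n. Qed.

Lemma continuous_coordinates (T : topologicalType) (f : T -> 'rV[R]_2) :
  continuous (fun p => xc (f p)) -> continuous (fun p => yc (f p)) -> continuous f.
Proof.
move=> cx cy.
rewrite (_ : f = fun p => xc (f p) *: polar 1 0 + yc (f p) *: polar 1 (pi / 2)).
  by move=> p; apply: cvgD; apply: cvgZr_tmp; [exact: cx|exact: cy].
apply/funext => p; apply: row2P; rewrite !mxE /= ?cos0 ?sin0 ?cos_pihalf ?sin_pihalf;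
  by rewrite !(mulr1, mulr0, addr0, add0r).
Qed.

Lemma continuous_rotation (a : R) : continuous (rotation a).
Proof.
apply: continuous_coordinates.
  rewrite (_ : (fun _ => _) = fun x : 'rV[R]_2 => cos a * xc x + - sin a * yc x).
    exact: continuous_affine_rV.
  by apply/funext => x; rewrite mxE /= mulNr.
rewrite (_ : (fun _ => _) = fun x : 'rV[R]_2 => sin a * xc x + cos a * yc x).
  exact: continuous_affine_rV.
by apply/funext => x; rewrite mxE.
Qed.

Lemma continuous_power_map n : continuous (@power_map R n).
Proof.
have c j : continuous (fun z : 'rV[R]_2 => z 0 j) by exact: coord_continuous.
suff [c1 c2] : continuous (fun x : 'rV[R]_2 => (cpow n x).1) /\
    continuous (fun x : 'rV[R]_2 => (cpow n x).2).
  apply: continuous_coordinates.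
    by rewrite (_ : (fun _ => _) = fun x : 'rV[R]_2 => (cpow n x).1) //; apply/funext => x; rewrite mxE.
  by rewrite (_ : (fun _ => _) = fun x : 'rV[R]_2 => (cpow n x).2) //; apply/funext => x; rewrite mxE.
elim: n => [|n [c1 c2]] /=; first by split; exact: cst_continuous.
split=> x.
  exact: (continuousB (continuousM (c ord0 x) (c1 x)) (continuousM (c ord_max x) (c2 x))).
exact: (continuousD (continuousM (c ord0 x) (c2 x)) (continuousM (c ord_max x) (c1 x))).
Qed.

Lemma continuous_orbit_map : continuous (@orbit_map R k).
Proof. exact: pi_continuous. Qed.

Lemma continuous_cone_to_disk : continuous (@cone_to_disk R k).
Proof.
apply/quotient_continuous.
rewrite (_ : _ \o _ = @power_map R k \o ( *:%R k%:R^-1)); last first.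
  by apply/funext => x; exact: cone_to_diskE.
move=> x; apply: continuous_comp; last exact: continuous_power_map.
exact: scaler_continuous.
Qed.

(** [cone_to_disk] is a continuous injection into a Hausdorff space. *)
Lemma hausdorff_orbit_space : hausdorff_space (@orbit_space R k).
Proof.
move=> p q pq; apply: (cone_to_disk_inj k0); apply: norm_hausdorff => A B Ap Bq.
have [||x [Ax Bx]] := pq (@cone_to_disk R k @^-1` A) (@cone_to_disk R k @^-1` B).
- exact: continuous_cone_to_disk.
- exact: continuous_cone_to_disk.
- by exists (cone_to_disk x).
Qed.

Lemma open_orbit_map (V : set 'rV[R]_2) : open V -> open (@orbit_map R k @` V).
Proof.
move=> oV; rewrite /open /= /quotient_open.
rewrite (_ : _ @^-1` _ =
    \bigcup_(m : int) (rotation (m%:~R * (2 * pi / k%:R)) @^-1` V)); last first.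
  apply/seteqP; split=> [x [y Vy /esym/orbit_mapP[_ [m ->] yx]]|x [m _ Vx]].
    by exists m => //=; rewrite -yx.
  exists (rotation (m%:~R * (2 * pi / k%:R)) x) => //; apply/esym/orbit_mapP.
  by exists (rotation (m%:~R * (2 * pi / k%:R))) => //; exists m.
apply: bigcup_open => m _; apply: open_comp => // x _; exact: continuous_rotation.
Qed.

Lemma cone_orbisurface (r : R) : 0 < r -> compact_riemannian_orbisurface (flat_cone k r).
Proof.
move=> r0; apply: rotation_quotient_orbisurface => //.
- exact: hausdorff_orbit_space.
- exact: continuous_orbit_map.
- exact: open_orbit_map.
- exact: orbit_mapP.
Qed.

Lemma cone_apex_singular (r : R) : (1 < k)%N -> 0 < r ->
  interior_singular_point (O := flat_cone k r) (orbit_map k 0).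
Proof.
move=> k1 r0; split.
  move=> /(quotient_bdE r0)[t /orbit_mapP[_ [m ->]]] /(congr1 (@sqnorm R)).
  rewrite sqnorm_rotation sqnorm_polar /sqnorm !mxE expr0n addr0 => /eqP.
  by rewrite sqrf_eq0 gt_eqF.
have q0 : 0 < 2 * pi / k%:R :> R by rewrite divr_gt0 ?mulr_gt0 ?pi_gt0 // ltr0n.
exists tt, 0, (rotation (1%:~R * (2 * pi / k%:R))); split.
- split=> //; apply/disk_domE; rewrite /sqnorm !mxE expr0n addr0.
  by rewrite exprn_ge0 // ltW.
- by exists 1.
- by apply: row2P; rewrite !mxE /= !mulr0 ?subr0 ?addr0.
exists (polar r 0); first by apply/disk_domE; rewrite sqnorm_polar.
(* If the generator fixed this point, [2 pi / k] would amount to [m] full turns, so that [m k = 1],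
   against [1 < k]. *)
rewrite rotation_polar addr0 mul1r => /(polar_eq _ _ r0)[m].
rewrite add0r => /(congr1 (fun x => x * (k%:R / (2 * pi)))).
have pin : pi != 0 :> R by rewrite gt_eqF // pi_gt0.
have E1 (P : R) : P != 0 -> P / k%:R * (k%:R / P) = 1.
  by move=> P0; field; rewrite P0 kn.
have E2 (P : R) : P != 0 -> m%:~R * P * (k%:R / P) = (m * k%:Z)%:~R.
  by move=> P0; rewrite intrM; field.
rewrite E1 ?E2 ?mulf_neq0 //.
rewrite -[1]/(1%:~R) => /intr_inj mk.
have : (k %| 1)%N.
  by have := congr1 absz mk; rewrite abszM /= => ->; rewrite dvdn_mull.
by rewrite dvdn1 => /eqP kk; rewrite kk in k1.
Qed.

Lemma cone_to_disk_maps_bd (p : orbit_space k) :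
  os_bd (flat_cone k (k%:R : R)) p -> os_bd (flat_disk (1 : R)) (cone_to_disk p).
Proof.
have kp : 0 < k%:R :> R by rewrite ltr0n.
move=> /(quotient_bdE kp)[t ->]; rewrite cone_to_disk_bd //.
by apply/(quotient_bdE (proj := id) ltr01); exists (k%:R * t).
Qed.

Lemma cone_to_disk_surj_bd (q : 'rV[R]_2) : os_bd (flat_disk (1 : R)) q ->
  exists2 p : orbit_space k, os_bd (flat_cone k (k%:R : R)) p & cone_to_disk p = q.
Proof.
have kp : 0 < k%:R :> R by rewrite ltr0n.
move=> /(quotient_bdE (proj := id) ltr01)[t ->].
exists (orbit_map k (polar k%:R (t / k%:R))).
  by apply/(quotient_bdE kp); exists (t / k%:R).
by rewrite cone_to_disk_bd // mulrC divfK.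
Qed.

Lemma cone_boundary_isometry :
  @boundary_isometry R (flat_cone k k%:R) (flat_disk 1) (@cone_to_disk R k).
Proof.
have kp : 0 < k%:R :> R by rewrite ltr0n.
split.
  split=> [p pb|p q _ _|q /cone_to_disk_surj_bd[p pb <-]].
  - exact: cone_to_disk_maps_bd.
  - exact: cone_to_disk_inj.
  - by exists p.
move=> [] c t /(arclength_circle kp)[e [th [e1 cE]]].
exists tt, (fun s => polar 1 (e * s / 1 + k%:R * th)); first exact: circle_arclength.
apply: filterS cE => s ->; rewrite /= cone_to_disk_bd //; congr polar.
by field.
Qed.

Lemma steklov_eigenspace_cone (sigma : R) (u : 'rV[R]_2 -> R) :
  steklov_eigenspace (O := flat_cone k k%:R) sigma (u \o @cone_to_disk R k) <->
  steklov_eigenspace (O := flat_disk 1) sigma u.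
Proof.
split=> -[su du].
  have {}su := (smooth_bd_cone u k0).1 su; split=> // _ /cone_to_disk_surj_bd[p pb <-].
  by rewrite -dn_cone // du.
split=> [|p pb]; first exact/smooth_bd_cone.
by rewrite dn_cone // du //; exact: cone_to_disk_maps_bd.
Qed.

Theorem cone_isospectral : steklov_isospectral (flat_cone k (k%:R : R)) (flat_disk 1).
Proof.
move=> sigma n; split=> [[w [wE wfree wspan]]|[u [uE ufree uspan]]].
  (* A left inverse of [cone_to_disk] on all of the orbit space, with an arbitrary value off its
     range. It writes every function on the cone as a pull-back, as the comparison of eigenspaces
     requires. *)
  pose psi (q : 'rV[R]_2) := xget (orbit_map k 0) [set p | cone_to_disk p = q].
  have psiK (p : orbit_space k) : psi (cone_to_disk p) = p.
    apply: (cone_to_disk_inj k0).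
    by apply: (@xgetPex _ _ [set p' | cone_to_disk p' = cone_to_disk p]); exists p.
  have wpsi l : (w l \o psi) \o @cone_to_disk R k = w l.
    by apply/funext => p /=; rewrite psiK.
  exists (fun l => w l \o psi); split.
  - by move=> l; apply/steklov_eigenspace_cone; rewrite wpsi.
  - move=> a ha; apply: wfree => p pb.
    have := ha _ (cone_to_disk_maps_bd pb); rewrite -[RHS]/0 => E.
    by rewrite -[RHS]E; apply: eq_bigr => l _ /=; rewrite psiK.
  - move=> v /steklov_eigenspace_cone/wspan[a va]; exists a.
    move=> _ /cone_to_disk_surj_bd[p pb <-]; rewrite -[LHS]/((v \o @cone_to_disk R k) p).
    by rewrite va //; apply: eq_bigr => l _ /=; rewrite psiK.
exists (fun l => u l \o @cone_to_disk R k); split.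
- by move=> l; apply/steklov_eigenspace_cone.
- move=> a ha; apply: ufree => _ /cone_to_disk_surj_bd[p pb <-]; exact: ha pb.
- move=> v vE.
  pose psi (q : 'rV[R]_2) := xget (orbit_map k 0) [set p | cone_to_disk p = q].
  have psiK (p : orbit_space k) : psi (cone_to_disk p) = p.
    apply: (cone_to_disk_inj k0).
    by apply: (@xgetPex _ _ [set p' | cone_to_disk p' = cone_to_disk p]); exists p.
  have vpsi : (v \o psi) \o @cone_to_disk R k = v.
    by apply/funext => p /=; rewrite psiK.
  rewrite -vpsi in vE; have [a va] := uspan _ ((steklov_eigenspace_cone _ _).1 vE).
  exists a => p /cone_to_disk_maps_bd/va /=; by rewrite psiK.
Qed.

End ConeTopology.

Lemma disk_surface {R : realType} : compact_riemannian_surface (flat_disk (1 : R)).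
Proof.
split; last by move=> p [i [x [a [_ -> _ [y _]]]]]; apply.
(* Rotations by multiples of [2 pi] are the identity, so the disk is the case [k = 1] of the
   quotient construction. *)
have GE : [set id] = @cyclic_rotations R 1.
  have rot1 (m : int) : rotation (m%:~R * (2 * pi / 1%:R)) = id :> ('rV[R]_2 -> 'rV[R]_2).
    apply/funext => x; have [rho [t [_ ->]]] := polar_exists x.
    rewrite rotation_polar divr1 addrC.
    by apply: row2P; rewrite ?polar_x ?polar_y ?cos_int2pi ?sin_int2pi.
  by apply/seteqP; split=> [_ ->|_ [m ->]]; [exists 0; rewrite rot1|rewrite rot1].
have := @rotation_quotient_orbisurface R 'rV[R]_2 id 1 1 (ltn0Sn 0) ltr01.
rewrite -GE image_id; apply => //.
- by move=> x; exact: cvg_id.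
- by move=> V; rewrite image_id.
- by move=> x y; split=> [->|[_ -> ->]] //; exists id.
Qed.

Theorem theorem1p5 (R : realType) :
  (forall k : nat, (0 < k)%N ->
     (exists2 r : R, 0 < r &
        boundary_circle_of_length (flat_cone k r) (2 * pi)) /\
     (forall r : R, 0 < r ->
        boundary_circle_of_length (flat_cone k r) (2 * pi) ->
        steklov_isospectral (flat_cone k r) (flat_disk 1)))
  /\
  (exists (O M : orbisurface R) (phi : os_top O -> os_top M),
     [/\ compact_riemannian_orbisurface O,
         exists p : os_top O, interior_singular_point p,
         compact_riemannian_surface M /\ os_bd M !=set0,
         boundary_isometry phi &
         forall u : os_top M -> R, smooth_bd u ->
           forall p : os_top O, os_bd O p ->
             dn_operator (u \o phi) p = dn_operator u (phi p)]).
Proof.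
split=> [k k0|].
  split=> [|r r0 /(cone_radius k0 r0)->]; last exact: cone_isospectral.
  by exists k%:R; [rewrite ltr0n|exact: cone_boundary_length].
(* [k = 2] is the least order with a singular apex, and radius 2 gives the boundary length
   [2 pi]. *)
exists (flat_cone 2 2%:R), (flat_disk 1), (@cone_to_disk R 2); split.
- exact: cone_orbisurface.
- by exists (orbit_map 2 0); exact: cone_apex_singular.
- split; first exact: disk_surface.
  exists (polar 1 0); apply/(quotient_bdE (proj := id) ltr01); by exists 0.
- exact: cone_boundary_isometry.
- by move=> u su p pb; exact: dn_cone.
Qed.
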